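(* Let $f\in\mathcal F$ be of powerfree-type or powerfull-type, defined via $(\varepsilon_j)$. Then the Algorithm described below terminates after finitely many steps, its output $\ell$ is the critical index of $f$, and its outputs $c_1<c_2<\dots<c_M$ are exactly the principal indices of $f$. Moreover, for $\sigma>1$, \[ D_f(s)=U_{2\ell}(s)\cdot\frac{\prod_{j=1}^M\zeta(c_js)}{\zeta(\ell s)^{n_\ell-\varepsilon_\ell}}\cdot\prod_{j=\ell+1}^{2\ell}\zeta(js)^{a_j}, \] where $n_\ell$ is the number of representations of $\ell$ from $\{c_1,\dots,c_M\}$, \[ a_j=\begin{cases}\displaystyle\sum_{I\subset\{1,\dots,M\}}(-1)^{\#I}\varepsilon_{j-\sum_{i\in I}c_i},&\ell+1\le j\le 2\ell-1,\\[2ex] \displaystyle-\frac{(\varepsilon_\ell-n_\ell)^2+\varepsilon_\ell-n_\ell}{2}+\sum_{I\subset\{1,\dots,M\}}(-1)^{\#I}\varepsilon_{2\ell-\sum_{i\in I}c_i},&j=2\ell,\end{cases} \] with the conventions $\varepsilon_0=1$ and $\varepsilon_j=0$ for $j<0$, and $U_{2\ell}(s)=\prod_p\bigl(1+\sum_{j=2\ell+1}^\infty\eta_jp^{-js}\bigr)$, where there exist constants $A,B$ depending only on $\ell$ such that $|\eta_j|\le(Aj)^B$ for all $j\ge2\ell+1$.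
   Context: A fake $\mu$ is a multiplicative arithmetic function $f$ for which there is a sequence $(\varepsilon_j)_{j\ge1}$ with each $\varepsilon_j\in\{-1,0,1\}$ such that $f(p^j)=\varepsilon_j$ for every prime $p$ and every $j\ge1$. Let $\mathcal{F}$ be the set of fake $\mu$'s that are neither the indicator function of $\{1\}$ nor the indicator function of the set of $k$th powers for any $k\ge1$. For $f\in\mathcal F$, $D_f(s)=\sum_{n\ge1}f(n)n^{-s}$ ($\sigma>1$). The initial index of $f$ is the least $j$ with $\varepsilon_j\ne0$. $f$ is of powerfree-type if $\varepsilon_1=1$; of powerfull-type if its initial index $k$ satisfies $k\ge2$ and $\varepsilon_k=1$. There is a unique sequence of integers $(a_j)_{j\ge1}$ with $1+\sum_{j\ge1}\varepsilon_jX^j=\prod_{j\ge1}(1-X^j)^{-a_j}$ as formal power series (equivalently, for each $L$, $D_f(s)=\prod_{j=1}^{L}\zeta(js)^{a_j}\prod_p(1+\sum_{j\ge L+1}\eta_jp^{-js})$ for $\sigma>1$). The critical index of $f$ is the least $\ell$ with $a_\ell<0$, and the principal indices of $f$ are those $1\le j\le\ell-1$ with $a_j>0$. For a positive integer $j$ and a set $\{c_1,\dots,c_m\}$ of positive integers, the number of representations of $j$ from $\{c_1,\dots,c_m\}$ is the number of tuples $(\alpha_1,\dots,\alpha_m)$ of nonnegative integers with $\sum_i\alpha_ic_i=j$. Algorithm: set $c_1$ to be the initial index of $f$, $m=1$, $j=c_1+1$. Repeat: let $n_j$ be the number of representations of $j$ from $\{c_1,\dots,c_m\}$; if $n_j=0$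 and $\varepsilon_j=1$, set $c_{m+1}=j$ and increase $m$ by $1$; then, if $n_j>\varepsilon_j$, set $M=m$, $\ell=j$, output $\ell,c_1,\dots,c_M$ and stop; otherwise increase $j$ by $1$ and repeat. *)

(* Defs.v *)
From HB Require Import structures.
From mathcomp Require Import all_boot all_order all_algebra.
From mathcomp Require Import all_classical all_reals all_analysis.
From mathcomp Require Import complex.

Set Implicit Arguments.
Unset Strict Implicit.
Unset Printing Implicit Defensive.

Import Order.TTheory GRing.Theory Num.Theory.
Import numFieldNormedType.Exports.

Local Open Scope classical_set_scope.
Local Open Scope ring_scope.
Local Open Scope complex_scope.

(* An arithmetic function is a map [nat -> int] whose value at 0 is never used
   (fake mu's only take the values -1, 0, 1); likewise only [eps 1], [eps 2],
   ... matter in a sequence [eps], and [a 1], [a 2], ... in a sequence [a]. *)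

Definition multiplicative (f : nat -> int) : Prop :=
  f 1%N = 1 /\
  forall m n : nat, (0 < m)%N -> (0 < n)%N -> coprime m n ->
    f (m * n)%N = f m * f n.

Definition fake_mu (f eps : nat -> int) : Prop :=
  [/\ multiplicative f,
      forall j : nat, (0 < j)%N -> eps j \in [:: -1; 0; 1] &
      forall p j : nat, prime p -> (0 < j)%N -> f (p ^ j)%N = eps j].

Definition is_indicator_of (f : nat -> int) (S : set nat) : Prop :=
  forall n : nat, (0 < n)%N -> f n = \1_S n.

Definition kth_powers (k : nat) : set nat := range (fun m : nat => (m ^ k)%N).

Definition in_F (f : nat -> int) : Prop :=
  [/\ exists eps : nat -> int, fake_mu f eps,
      ~ is_indicator_of f [set 1%N] &
      forall k : nat, (0 < k)%N -> ~ is_indicator_of f (kth_powers k)].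

Definition initial_index (eps : nat -> int) (k : nat) : Prop :=
  [/\ (0 < k)%N, eps k != 0 &
      forall j : nat, (0 < j < k)%N -> eps j = 0].

Definition powerfree_type (eps : nat -> int) : Prop := eps 1%N = 1.

Definition powerfull_type (eps : nat -> int) : Prop :=
  exists k : nat, [/\ initial_index eps k, (2 <= k)%N & eps k = 1].

Definition eps_ext (eps : nat -> int) (j : int) : int :=
  match j with
  | Posz 0%N => 1
  | Posz n => eps n
  | Negz _ => 0
  end.

Definition fps := nat -> int.

Definition fps_one : fps := fun n => (n == 0%N)%:R.

Definition fps_mul (u v : fps) : fps :=
  fun n => \sum_(i < n.+1) u i * v (n - i)%N.

Definition fps_exp (u : fps) (k : nat) : fps := iter k (fps_mul u) fps_one.

(* 1 - X^j, for j > 0 *)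
Definition fps_1subXn (j : nat) : fps :=
  fun n => (n == 0%N)%:R - (n == j)%:R.

(* (1 - X^j)^-1 = \sum_m X^(j m), for j > 0 *)
Definition fps_geom (j : nat) : fps := fun n => (j %| n)%:R.

(* (1 - X^j)^(-a) *)
Definition fps_factor (j : nat) (a : int) : fps :=
  match a with
  | Posz k => fps_exp (fps_geom j) k
  | Negz k => fps_exp (fps_1subXn j) k.+1
  end.

Fixpoint fps_prod (a : nat -> int) (L : nat) : fps :=
  if L is L'.+1 then fps_mul (fps_prod a L') (fps_factor L (a L)) else fps_one.

(* 1 + \sum_(j >= 1) eps_j X^j = \prod_(j >= 1) (1 - X^j)^(-a_j).  The factors
   of index j > n do not affect the coefficient of X^n, so the infinite product
   is the coefficientwise eventual value of its partial products. *)
Definition zeta_exponents (eps a : nat -> int) : Prop :=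
  forall n L : nat, (n <= L)%N -> fps_prod a L n = eps_ext eps n%:Z.

Definition critical_index (a : nat -> int) (l : nat) : Prop :=
  [/\ (0 < l)%N, a l < 0 & forall j : nat, (0 < j < l)%N -> 0 <= a j].

(* Here [l] is meant to be the critical index. *)
Definition principal_index (a : nat -> int) (l j : nat) : Prop :=
  (0 < j < l)%N /\ 0 < a j.

(* The c_i are positive in all uses, so that alpha_i <= alpha_i * c_i <= j and
   the tuples can be taken with entries in {0, ..., j}. *)
Definition nrep (cs : seq nat) (j : nat) : nat :=
  #|[set alpha : {ffun 'I_(size cs) -> 'I_j.+1} |
      (\sum_(i < size cs) alpha i * nth 0 cs i == j)%N]|.

(* At most [fuel] rounds of the loop, started at [j] with the list
   [cs = [:: c_1; ...; c_m]]; [None] means that it has not stopped yet. *)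
Fixpoint algorithm_loop (eps : nat -> int) (fuel j : nat) (cs : seq nat) :
    option (nat * seq nat) :=
  if fuel is fuel'.+1 then
    let n := nrep cs j in
    let cs' := if (n == 0%N) && (eps j == 1) then rcons cs j else cs in
    if eps j < n%:Z then Some (j, cs')
    else algorithm_loop eps fuel' j.+1 cs'
  else None.

Definition algorithm_outputs (eps : nat -> int) (l : nat) (cs : seq nat) : Prop :=
  exists c1 fuel : nat, initial_index eps c1 /\
    algorithm_loop eps fuel c1.+1 [:: c1] = Some (l, cs).

Definition alt_sum (eps : nat -> int) (cs : seq nat) (j : nat) : int :=
  \sum_(I : {set 'I_(size cs)})
    (-1) ^+ #|I| * eps_ext eps (j%:Z - (\sum_(i in I) nth 0 cs i)%N%:Z).

Section Analytic.
Variable R : realType.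

Definition cexp (z : R[i]) : R[i] :=
  (expR (complex.Re z))%:C * (cos (complex.Im z) +i* sin (complex.Im z)).

(* n^(-s), for n > 0 *)
Definition nat_cpowN (n : nat) (s : R[i]) : R[i] := cexp (- s * (ln n%:R)%:C).

(* [R[i]^o] is [R[i]] seen as a normed space over itself; this is what carries
   the topology. *)
Definition dirichlet_series (f : nat -> int) (s : R[i]) : R[i] :=
  limn (fun N : nat =>
    \sum_(1 <= n < N) (f n)%:~R * nat_cpowN n s : R[i]^o).

Definition zeta (s : R[i]) : R[i] := dirichlet_series (fun=> 1) s.

Definition local_sum (eta : nat -> int) (L : nat) (s : R[i]) (p N : nat) :
    R[i]^o :=
  \sum_(L.+1 <= j < N) (eta j)%:~R * nat_cpowN p (j%:R * s).

Definition local_factor (eta : nat -> int) (L : nat) (s : R[i]) (p : nat) :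
    R[i] :=
  1 + limn (local_sum eta L s p).

Definition partial_euler_product (eta : nat -> int) (L : nat) (s : R[i])
    (N : nat) : R[i]^o :=
  \prod_(1 <= p < N | prime p) local_factor eta L s p.

Definition euler_product (eta : nat -> int) (L : nat) (s : R[i]) : R[i] :=
  limn (partial_euler_product eta L s).

Definition euler_product_cvg (eta : nat -> int) (L : nat) (s : R[i]) : Prop :=
  (forall p : nat, prime p -> cvgn (local_sum eta L s p)) /\
  cvgn (partial_euler_product eta L s).

End Analytic.

Lemma fps_1subXn_geom (j : nat) : (0 < j)%N ->
  fps_mul (fps_1subXn j) (fps_geom j) =1 fps_one.
Proof.
move=> j0 n; rewrite /fps_mul /fps_1subXn /fps_geom /fps_one.
under eq_bigr do rewrite mulrBl.
rewrite sumrB (bigD1 ord0) //= big1 ?addr0 ?mul1r ?subn0; last first.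
  by move=> i; rewrite -val_eqE /= => /negPf ->; rewrite mul0r.
have [jn|nj] := leqP j n.
  rewrite (bigD1 (Ordinal (jn : (j < n.+1)%N))) //= big1 ?addr0; last first.
    by move=> i; rewrite -val_eqE /= => /negPf ->; rewrite mul0r.
  rewrite eqxx mul1r -{1}(subnK jn) dvdn_addl // subrr.
  by case: n jn => // /(leq_trans j0).
rewrite big1 ?subr0 => [|i _].
  by case: n nj => [|n] nj; rewrite ?dvdn0 // gtnNdvd.
by rewrite (ltn_eqF (leq_trans (ltn_ord i) nj)) mul0r.
Qed.

Lemma fps_mul_sparse (u v : fps) (j : nat) :
    v 0%N = 1 -> (forall i, (0 < i < j)%N -> v i = 0) ->
  (forall n, (n < j)%N -> fps_mul u v n = u n) /\
  ((0 < j)%N -> fps_mul u v j = u j + u 0%N * v j).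
Proof.
move=> v0 vs; split=> [n nj|j0]; rewrite /fps_mul.
  rewrite big_ord_recr /= subnn v0 mulr1 big1 ?add0r // => i _.
  by rewrite vs ?mulr0 // subn_gt0 ltn_ord (leq_ltn_trans (leq_subr _ _) nj).
rewrite big_ord_recr /= subnn v0 mulr1 addrC; congr (_ + _).
case: j j0 vs => // j _ vs; rewrite big_ord_recl /= subn0 big1 ?addr0 // => i _.
by rewrite vs ?mulr0 // /bump /= add1n subSS subn_gt0 ltn_ord ltnS leq_subr.
Qed.

Lemma fps_exp_sparse (u : fps) (j k : nat) : (0 < j)%N ->
    u 0%N = 1 -> (forall i, (0 < i < j)%N -> u i = 0) ->
  [/\ fps_exp u k 0%N = 1, forall i, (0 < i < j)%N -> fps_exp u k i = 0 &
      fps_exp u k j = u j *+ k].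
Proof.
move=> j0 u0 us; elim: k => [|k [e0 es ej]].
  split=> [//|i /andP[i0 _]|]; first by rewrite /= /fps_one gtn_eqF.
  by rewrite /= /fps_one gtn_eqF.
have [H1 H2] := fps_mul_sparse u e0 es.
split; first by rewrite [LHS]H1.
- by move=> i /andP[i0 ij]; rewrite [LHS]H1 // us // i0.
- by rewrite [LHS]H2 // u0 mul1r ej mulrS.
Qed.

Lemma fps_factor_sparse (j : nat) (a : int) : (0 < j)%N ->
  [/\ fps_factor j a 0%N = 1, forall i, (0 < i < j)%N -> fps_factor j a i = 0 &
      fps_factor j a j = a].
Proof.
move=> j0; case: a => k.
  have [||e0 es ej] := @fps_exp_sparse (fps_geom j) j k j0.
  - by rewrite /fps_geom dvdn0.
  - by move=> i /andP[i0 ij]; rewrite /fps_geom gtnNdvd.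
  - by split=> //; rewrite [LHS]ej /fps_geom dvdnn mulr1n natz.
have [||e0 es ej] := @fps_exp_sparse (fps_1subXn j) j k.+1 j0.
- by rewrite /fps_1subXn eqxx ltn_eqF // subr0.
- by move=> i /andP[i0 ij]; rewrite /fps_1subXn (gtn_eqF i0) (ltn_eqF ij).
- split=> //; rewrite [LHS]ej /fps_1subXn eqxx gtn_eqF // sub0r.
  by rewrite mulNrn natz NegzE.
Qed.

Lemma fps_prod0 (a : nat -> int) (L : nat) : fps_prod a L 0%N = 1.
Proof.
elim: L => //= L IH.
have [e0 es _] := fps_factor_sparse (a L.+1) (ltn0Sn L).
have [H _] := fps_mul_sparse (fps_prod a L) e0 es; by rewrite H.
Qed.

Lemma fps_prod_stable (a : nat -> int) (n L : nat) : (n <= L)%N ->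
  fps_prod a L n = fps_prod a n n.
Proof.
elim: L => [|L IH]; first by rewrite leqn0 => /eqP ->.
rewrite leq_eqVlt => /predU1P[-> //|nL]; rewrite -IH //=.
have [e0 es _] := fps_factor_sparse (a L.+1) (ltn0Sn L).
have [H _] := fps_mul_sparse (fps_prod a L) e0 es; by rewrite H.
Qed.

Lemma fps_prodS (a : nat -> int) (n : nat) :
  fps_prod a n.+1 n.+1 = fps_prod a n n.+1 + a n.+1.
Proof.
have [e0 es ej] := fps_factor_sparse (a n.+1) (ltn0Sn n).
have [_ H] := fps_mul_sparse (fps_prod a n) e0 es.
by rewrite [LHS]H // fps_prod0 mul1r ej.
Qed.

Lemma eq_fps_prod (a b : nat -> int) (L : nat) :
    (forall j, (0 < j <= L)%N -> a j = b j) -> fps_prod a L = fps_prod b L.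
Proof.
elim: L => //= L IH ab; rewrite IH ?ab ?ltnSn // => j /andP[j0 jL].
by rewrite ab // j0 leqW.
Qed.

Lemma zeta_exponents_exist (eps : nat -> int) :
  exists a : nat -> int, zeta_exponents eps a.
Proof.
pose fix b (n : nat) : nat -> int :=
  if n is m.+1 then
    fun j => if j == n then eps n - fps_prod (b m) m n else b m j
  else fun=> 0.
have bE n m : (n <= m)%N -> forall j, (j <= n)%N -> b m j = b n j.
  elim: m => [|m IH]; first by rewrite leqn0 => /eqP ->.
  rewrite leq_eqVlt => /predU1P[-> //|nm] j jn /=.
  by rewrite ltn_eqF ?IH // (leq_ltn_trans jn).
pose a j := b j j.
exists a => n L nL; rewrite fps_prod_stable //; case: n {nL} => [|n].
  by rewrite fps_prod0.
rewrite fps_prodS {2}/a /= eqxx (@eq_fps_prod a (b n)) => [|j /andP[_ jn]].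
  by rewrite addrC subrK.
by rewrite /a (bE j n).
Qed.

Lemma zeta_exponents_unique (eps a b : nat -> int) :
    zeta_exponents eps a -> zeta_exponents eps b ->
  forall j : nat, (0 < j)%N -> a j = b j.
Proof.
move=> Ha Hb j; elim/ltn_ind: j => -[//|j] IH _.
have := Ha _ _ (leqnn j.+1); rewrite -(Hb _ _ (leqnn j.+1)) !fps_prodS.
rewrite (@eq_fps_prod a b) => [/addrI //|i /andP[i0 ij]].
exact: IH.
Qed.

(* Main.v *)
Require Import Defs.
From HB Require Import structures.
From mathcomp Require Import all_boot all_order all_algebra.
From mathcomp Require Import all_classical all_reals all_analysis.
From mathcomp Require Import complex.
From mathcomp Require Import zify ring lra.
Set Implicit Arguments.
Unset Strict Implicit.
Unset Printing Implicit Defensive.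
Import Order.TTheory GRing.Theory Num.Theory.
Import numFieldNormedType.Exports.
Local Open Scope classical_set_scope.
Local Open Scope ring_scope.
Local Open Scope complex_scope.

(* The Algorithm matches 1 + \sum eps_j X^j against products of geometric series:
   when it enters round j, its list cs satisfies
   1 + \sum eps_j X^j = \prod_(c in cs) (1 - X^c)^-1 below degree j, the n-th
   coefficient of the right-hand side being the number of representations of n.
   It stops at the first l where that number exceeds eps_l, so a_j is 1 or 0 for
   j < l according as j is in cs, and a_l = eps_l - n_l < 0.  If it never stopped,
   either cs = [:: c1] forever and f is the indicator of the c1-th powers, or
   c1 c2 has two representations, which exceeds eps_(c1 c2) <= 1.  Multiplying by
   \prod_(c in cs) (1 - X^c) leaves \prod_(j >= l) (1 - X^j)^(-a_j), whose
   coefficients in degrees l + 1, ..., 2l are the a_j, up to the contribution of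
   (1 - X^l)^(-a_l) in degree 2l.

   The coefficients eta_j are those of
   (1 + \sum eps_j X^j) \prod_(j <= 2l) (1 - X^j)^(a_j), which is dominated by a
   power of 1 / (1 - X) whose exponent is bounded in terms of l.  Evaluating at
   X = p^-s and multiplying over the primes p < N, the Euler products of f and
   of the zeta(js), which do not vanish, give both the convergence of the
   product over p and its value. *)

(** * The ring of formal power series *)

Definition fps_add (u v : fps) : fps := fun n => u n + v n.
Definition fps_opp (u : fps) : fps := fun n => - u n.
Definition fps_zero : fps := fun=> 0.

(** A coefficient of a product only involves coefficients of no larger index, so truncation
    transfers commutativity and associativity from [{poly int}]. *)
Lemma fps_mul_coef (u v : fps) (N n : nat) : (n < N)%N ->
  fps_mul u v n = (\poly_(i < N) u i * \poly_(i < N) v i)`_n.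
Proof.
move=> nN; rewrite coefM; apply: eq_bigr => i _; rewrite !coef_poly.
by rewrite !ifT // ?(leq_trans (ltn_ord i)) // (leq_ltn_trans _ nN) ?leq_subr.
Qed.

Lemma fps_addA : associative fps_add.
Proof. by move=> u v w; apply: funext => n; exact: addrA. Qed.

Lemma fps_addC : commutative fps_add.
Proof. by move=> u v; apply: funext => n; exact: addrC. Qed.

Lemma fps_add0 : left_id fps_zero fps_add.
Proof. by move=> u; apply: funext => n; exact: add0r. Qed.

Lemma fps_addN : left_inverse fps_zero fps_opp fps_add.
Proof. by move=> u; apply: funext => n; exact: addNr. Qed.

Lemma fps_mulC : commutative fps_mul.
Proof.
by move=> u v; apply: funext => n; rewrite !(fps_mul_coef _ _ (ltnSn n)) mulrC.
Qed.

Lemma fps_mulA : associative fps_mul.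
Proof.
have mul3 u v w n : fps_mul u (fps_mul v w) n =
    (\poly_(i < n.+1) u i * (\poly_(i < n.+1) v i * \poly_(i < n.+1) w i))`_n.
  rewrite coefM; apply: eq_bigr => i _; rewrite coef_poly ltn_ord.
  by rewrite (@fps_mul_coef v w n.+1) // ltnS leq_subr.
move=> u v w; apply: funext => n.
by rewrite mul3 fps_mulC mul3 mulrA mulrC.
Qed.

Lemma fps_mul1 : left_id fps_one fps_mul.
Proof.
move=> u; apply: funext => n; rewrite /fps_mul big_ord_recl big1 ?addr0.
  by rewrite /fps_one mul1r subn0.
by move=> i _; rewrite /fps_one mul0r.
Qed.

Lemma fps_mulDl : left_distributive fps_mul fps_add.
Proof.
move=> u v w; apply: funext => n; rewrite /fps_add /fps_mul -big_split /=.
by apply: eq_bigr => i _; rewrite mulrDl.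
Qed.

HB.instance Definition _ := gen_eqMixin fps.
HB.instance Definition _ := gen_choiceMixin fps.
HB.instance Definition _ :=
  GRing.isZmodule.Build fps fps_addA fps_addC fps_add0 fps_addN.

Fact fps_one_neq0 : fps_one != 0 :> fps.
Proof. by apply/eqP => /(congr1 (fun u : fps => u 0%N)). Qed.

HB.instance Definition _ := GRing.Zmodule_isComNzRing.Build fps
  fps_mulA fps_mulC fps_mul1 fps_mulDl fps_one_neq0.

Lemma fps_coefM (u v : fps) (n : nat) :
  (u * v) n = \sum_(i < n.+1) u i * v (n - i)%N.
Proof. by []. Qed.

Lemma fps_coef1 (n : nat) : (1 : fps) n = (n == 0%N)%:R.
Proof. by []. Qed.

Lemma fps_expE (u : fps) (k : nat) : fps_exp u k = u ^+ k.
Proof. by elim: k => // k IH; rewrite exprS -IH. Qed.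

Lemma fps_geomK (j : nat) : (0 < j)%N -> fps_1subXn j * fps_geom j = 1 :> fps.
Proof. by move=> j0; apply: funext => n; exact: fps_1subXn_geom. Qed.

Lemma fps_factorN (j : nat) (a : int) : (0 < j)%N ->
  fps_factor j (- a) * fps_factor j a = 1.
Proof.
move=> j0; case: a => [[|k]|k].
- exact: mulr1.
- change (fps_exp (fps_1subXn j) k.+1 * fps_exp (fps_geom j) k.+1 = 1 :> fps).
  by rewrite !(fps_expE _ k.+1) -exprMn fps_geomK // expr1n.
- change (fps_exp (fps_geom j) k.+1 * fps_exp (fps_1subXn j) k.+1 = 1 :> fps).
  by rewrite !(fps_expE _ k.+1) -exprMn mulrC fps_geomK // expr1n.
Qed.

Lemma fps_prodE (a : nat -> int) (L : nat) :
  fps_prod a L = \prod_(1 <= j < L.+1) fps_factor j (a j).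
Proof.
elim: L => [|L IH]; first by rewrite big_nil.
by rewrite big_nat_recr // -IH.
Qed.

Lemma fps_prodN (a : nat -> int) (L : nat) :
  fps_prod (fun j => - a j) L * fps_prod a L = 1.
Proof.
rewrite !fps_prodE -big_split /= big_nat_cond big1 // => j /andP[/andP[j0 _] _].
exact: fps_factorN.
Qed.

(** At each index one of the two factors is [fps_factor j 0], which is 1. This later separates the
    principal indices from the indices at least [l]. *)
Lemma fps_prod_disjoint (a b c : nat -> int) (L : nat) :
    (forall j, (0 < j <= L)%N -> c j = a j /\ b j = 0 \/ c j = b j /\ a j = 0)
      ->
  fps_prod c L = fps_prod a L * fps_prod b L.
Proof.
move=> abc; rewrite !fps_prodE -big_split /= !big_nat; apply: eq_bigr => j jL.
have [[-> ->]|[-> ->]] := abc j jL;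
  first by rewrite [fps_factor j 0]/(1 : fps) mulr1.
by rewrite [fps_factor j 0]/(1 : fps) mul1r.
Qed.

(** * Polynomial growth of coefficients *)

Definition poly_bounded (K : nat) (u : fps) : Prop :=
  forall n, `|u n| <= (n.+1 ^ K)%:Z.

Lemma poly_bounded_le (K K' : nat) (u : fps) : (K <= K')%N ->
  poly_bounded K u -> poly_bounded K' u.
Proof.
move=> KK uK n; apply: le_trans (uK n) _.
by rewrite lez_nat leq_pexp2l.
Qed.

(** A coefficient of the product is a sum of [n + 1] terms, each at most [(n + 1)^K] in absolute
    value, which costs one more power. *)
Lemma poly_boundedM (K : nat) (u v : fps) :
    poly_bounded K u -> (forall n, `|v n| <= 1) ->
  poly_bounded K.+1 (u * v).
Proof.
move=> uK v1 n; rewrite fps_coefM.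
apply: le_trans (ler_norm_sum _ _ _) _.
apply: (@le_trans _ _ (\sum_(i < n.+1) (n.+1 ^ K)%:Z)).
  apply: ler_sum => i _; rewrite normrM.
  apply: le_trans (ler_pM _ _ (uK i) (v1 _)) _ => //.
  by rewrite mulr1 lez_nat; case: K {uK} => // K; rewrite leq_exp2r.
by rewrite sumr_const card_ord -mulr_natr natz -PoszM expnSr.
Qed.

Lemma fps_geom_le1 (j n : nat) : `|fps_geom j n| <= 1.
Proof. by rewrite /fps_geom; case: (_ %| _)%N. Qed.

Lemma fps_1subXn_le1 (j n : nat) : (0 < j)%N -> `|fps_1subXn j n| <= 1.
Proof.
by rewrite /fps_1subXn; case: n => [|n]; case: j => [|j] //= _; case: eqP.
Qed.

Lemma poly_boundedM_exp (K k : nat) (u v : fps) :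
    poly_bounded K u -> (forall n, `|v n| <= 1) ->
  poly_bounded (K + k) (u * fps_exp v k).
Proof.
move=> uK v1; rewrite fps_expE; elim: k => [|k IH];
  first by rewrite addn0 mulr1.
by rewrite addnS exprSr mulrA; exact: poly_boundedM.
Qed.

(** The factor is a product of [|a|] copies of [(1 - X^j)^-1] or of [1 - X^j], whose coefficients
    lie in {-1, 0, 1}; each copy costs one power. *)
Lemma poly_boundedM_factor (K j : nat) (a : int) (u : fps) : (0 < j)%N ->
  poly_bounded K u -> poly_bounded (K + `|a|) (u * fps_factor j a).
Proof.
move=> j0 uK; case: a => k; apply: poly_boundedM_exp => // n.
  exact: fps_geom_le1.
exact: fps_1subXn_le1.
Qed.

Lemma poly_boundedM_prod (K L : nat) (a : nat -> int) (u : fps) :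
    poly_bounded K u ->
  poly_bounded (K + \sum_(1 <= j < L.+1) `|a j|)%N (u * fps_prod a L).
Proof.
move=> uK; elim: L => [|L IH]; first by rewrite big_nil addn0 mulr1.
rewrite big_nat_recr //= addnA [fps_mul _ _]/(_ * _ : fps) mulrA.
exact: poly_boundedM_factor.
Qed.

Lemma poly_bounded1 : poly_bounded 0 1.
Proof. by case. Qed.

(* The exponent a_(n+1) is the difference of a coefficient in {-1, 0, 1} and of
   the coefficient of X^(n+1) in the product of the first n factors. *)
Fixpoint exponent_bound (n : nat) : nat :=
  if n is m.+1 then (exponent_bound m + (1 + m.+2 ^ exponent_bound m))%N else 0.

(** The bound is independent of [eps], which is why the final constants depend on [l] alone. By
    induction the first [n] factors have total exponent at most [exponent_bound n], so in their
    product the coefficient of [X^(n+1)] is at most [(n + 2)^(exponent_bound n)] in absolute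
    value. *)
Lemma sum_exponents_le (eps a : nat -> int) (n : nat) :
    (forall j, (0 < j)%N -> `|eps j| <= 1) -> zeta_exponents eps a ->
  (\sum_(1 <= j < n.+1) `|a j| <= exponent_bound n)%N.
Proof.
move=> eps1 aP; elim: n => [|n IH]; first by rewrite big_nil.
rewrite big_nat_recr //= leq_add //.
have := aP _ _ (leqnn n.+1); rewrite fps_prodS /= => /(canRL (addKr _)) ->.
have := poly_boundedM_prod n a poly_bounded1; rewrite add0n mul1r.
move=> /(poly_bounded_le IH) /(_ n.+1) => H.
rewrite -lez_nat abszE PoszD.
apply: le_trans (ler_normD _ _) _; rewrite normrN [leRHS]addrC.
by apply: lerD => //; exact: eps1.
Qed.

Definition fps_eps (eps : nat -> int) : fps := fun n => eps_ext eps n%:Z.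

Lemma fps_eps_le1 (eps : nat -> int) (n : nat) :
  (forall j, (0 < j)%N -> `|eps j| <= 1) -> `|fps_eps eps n| <= 1.
Proof. by case: n => // n eps1; exact: eps1. Qed.

Lemma poly_bounded_eps (eps : nat -> int) :
  (forall j, (0 < j)%N -> `|eps j| <= 1) -> poly_bounded 0 (fps_eps eps).
Proof. by move=> eps1 n; rewrite expn0 fps_eps_le1. Qed.

(* The paper's 1 + \sum_(j > L) eta_j X^j. *)
Definition remainder (eps a : nat -> int) (L : nat) : fps :=
  fps_eps eps * fps_prod (fun j => - a j) L.

(** Up to degree [L] the series [fps_eps eps] agrees with [fps_prod a L], of which the second factor
    of [remainder] is the inverse. *)
Lemma remainder_low (eps a : nat -> int) (L n : nat) :
  zeta_exponents eps a -> (n <= L)%N -> remainder eps a L n = (n == 0%N)%:R.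
Proof.
move=> aP nL; rewrite -fps_coef1 -(fps_prodN a L) [in RHS]mulrC !fps_coefM.
by apply: eq_bigr => i _; rewrite aP // (leq_trans _ nL) // -ltnS.
Qed.

Lemma remainder_bounded (eps a : nat -> int) (L : nat) :
    (forall j, (0 < j)%N -> `|eps j| <= 1) -> zeta_exponents eps a ->
  poly_bounded (exponent_bound L) (remainder eps a L).
Proof.
move=> eps1 aP; apply: poly_bounded_le (sum_exponents_le L eps1 aP) _.
have := poly_boundedM_prod L (fun j => - a j) (poly_bounded_eps eps1).
by under eq_bigr do rewrite abszN.
Qed.

(** * Representation counts and alternating sums as coefficients *)

Lemma coef_congr_prod (I : Type) (r : seq I) (P : I -> {poly int})
    (U : I -> fps) (n : nat) :
    (forall i k, (k <= n)%N -> (P i)`_k = U i k) ->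
  forall k, (k <= n)%N -> (\prod_(i <- r) P i)`_k = (\prod_(i <- r) U i : fps)
    k.
Proof.
move=> PU; elim: r => [|i r IH] k kn; first by rewrite !big_nil coef1.
rewrite !big_cons coefM fps_coefM; apply: eq_bigr => j _.
have jk : (j <= k)%N by rewrite -ltnS.
by rewrite PU ?IH //; apply: leq_trans kn; rewrite ?leq_subr.
Qed.

(** Distributing the product of the truncated geometric sums [P i] gives one monomial
    [X^(\sum_i alpha_i c_i)] per tuple [alpha]. The truncation at [k <= n] matches the range of the
    tuples in [nrep]. *)
Lemma nrepE (cs : seq nat) (n : nat) : {in cs, forall c, (0 < c)%N} ->
  (nrep cs n)%:Z = (\prod_(c <- cs) fps_geom c : fps) n.
Proof.
move=> cs0; pose c i := nth 0 cs i.
pose P (i : 'I_(size cs)) : {poly int} := \sum_(k < n.+1) 'X^(k * c i).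
rewrite (big_nth 0%N) big_mkord -(@coef_congr_prod _ _ P _ n) //; last first.
  move=> i k kn; rewrite coef_sum /fps_geom.
  have ci0 : (0 < c i)%N by rewrite cs0 // mem_nth.
  have [/dvdnP[q kq]|ndvd] := boolP (c i %| k)%N.
    have qn : (q < n.+1)%N.
      by rewrite ltnS (leq_trans _ kn) // kq leq_pmulr.
    rewrite (bigD1 (Ordinal qn)) //= coefXn kq eqxx big1 ?addr0 // => j.
    rewrite -val_eqE /= coefXn eqn_pmul2r // eq_sym => /negPf ->.
    by [].
  rewrite big1 // => j _; rewrite coefXn; case: eqP => // kj.
  by rewrite kj dvdn_mull in ndvd.
rewrite /P bigA_distr_bigA coef_sum /nrep -sum1_card.
rewrite -[LHS]natz natr_sum big_mkcond /=; apply: eq_bigr => f _.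
rewrite prodrXr coefXn eq_sym unfold_in /= asboolb.
by case: (_ == n).
Qed.

(** Distributing the product of the [1 - X^(c_i)] over the subsets [J] gives the signed monomials
    [(-1)^#J X^(\sum_(i in J) c_i)], and multiplication by such a monomial shifts the index of
    [eps]. *)
Lemma alt_sumE (eps : nat -> int) (cs : seq nat) (n : nat) :
  alt_sum eps cs n = (fps_eps eps * \prod_(c <- cs) fps_1subXn c) n.
Proof.
pose c i := nth 0 cs i.
rewrite (big_nth 0%N) big_mkord mulrC fps_coefM.
pose P (i : 'I_(size cs)) : {poly int} := - 'X^(c i) + 1.
have PE k : (k <= n)%N ->
    (\prod_(i < size cs) fps_1subXn (c i) : fps) k =
    \sum_(J : {set 'I_(size cs)}) (-1) ^+ #|J| * (k == \sum_(i in J) c i)%N%:R.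
  move=> kn; rewrite -(@coef_congr_prod _ _ P _ n) //; last first.
    by move=> i j _; rewrite coefD coefN coefXn coef1 addrC.
  rewrite /P bigA_distr coef_sum; apply: eq_bigr => J _.
  rewrite -big_mkcond /= prodrN prodrXr -signr_odd -[in RHS]signr_odd.
  by case: odd; rewrite ?expr1 ?expr0 ?mulN1r ?mul1r ?coefN coefXn.
under eq_bigr => i _ do rewrite PE -1?ltnS // mulr_suml.
rewrite exchange_big /=; apply: eq_bigr => J _.
set S := (\sum_(i in J) c i)%N.
under eq_bigr do rewrite -mulrA.
rewrite -mulr_sumr; congr (_ * _).
have [Sn|nS] := leqP S n.
  rewrite (bigD1 (Ordinal (Sn : (S < n.+1)%N))) //= eqxx mul1r big1 ?addr0.
    by rewrite /fps_eps subzn.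
  by move=> i; rewrite -val_eqE /= => /negPf ->; rewrite mul0r.
(* When [S] exceeds [n] no coefficient is hit, in accordance with the convention that [eps_ext]
   vanishes at negative arguments. *)
rewrite big1 => [|i _];
  last by rewrite ltn_eqF ?mul0r // (leq_ltn_trans _ nS) // -ltnS.
have : (n%:Z - S%:Z < 0) by rewrite subr_lt0 ltz_nat.
by case: (n%:Z - S%:Z).
Qed.

(** * The algorithm *)

(** For positive entries this is the generating series of [nrep cs], by [nrepE]. *)
Definition fps_rep (cs : seq nat) : fps := \prod_(c <- cs) fps_geom c.

Lemma fps_geom_sparse (j : nat) :
  fps_geom j 0%N = 1 /\ forall i, (0 < i < j)%N -> fps_geom j i = 0.
Proof.
by split=> [|i /andP[i0 ij]]; rewrite /fps_geom ?dvdn0 // gtnNdvd.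
Qed.

Lemma fps_rep_rcons (cs : seq nat) (j : nat) :
  fps_rep (rcons cs j) = fps_rep cs * fps_geom j.
Proof. by rewrite /fps_rep -cats1 big_cat big_seq1. Qed.

Lemma fps_rep0 (cs : seq nat) : fps_rep cs 0%N = 1.
Proof.
elim/last_ind: cs => [|cs c IH]; first by rewrite /fps_rep big_nil.
by rewrite fps_rep_rcons fps_coefM big_ord1 IH /fps_geom dvdn0 mulr1.
Qed.

Lemma fps_rep_ge0 (cs : seq nat) (n : nat) : 0 <= fps_rep cs n.
Proof.
elim/last_ind: cs n => [|cs c IH] n.
  by rewrite /fps_rep big_nil fps_coef1; case: eqP.
rewrite fps_rep_rcons fps_coefM sumr_ge0 // => i _.
by rewrite mulr_ge0 ?IH // /fps_geom; case: (_ %| _)%N.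
Qed.

(** The number [c d] is both [d] times [c] and [c] times [d]: these are the two extreme terms of the
    convolution. The remaining factors have constant coefficient 1 and nonnegative coefficients, so
    they cannot lower the count. *)
Lemma fps_rep_ge2 (c d : nat) (cs : seq nat) : (0 < c)%N -> (0 < d)%N ->
  2 <= fps_rep [:: c, d & cs] (c * d)%N.
Proof.
move=> c0 d0; have n0 : (0 < c * d)%N by rewrite muln_gt0 c0.
have cdc : (c %| c * d)%N := dvdn_mulr d (dvdnn c).
have cdd : (d %| c * d)%N := dvdn_mull c (dvdnn d).
have gM n : 0 <= (fps_geom c * fps_geom d) n.
  by rewrite fps_coefM sumr_ge0 // => k _; rewrite mulr_ge0 // /fps_geom;
    case: (_ %| _)%N.
have gM2 : 2 <= (fps_geom c * fps_geom d) (c * d)%N.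
  case: (c * d)%N n0 cdc cdd => // n _ cn dn.
  rewrite fps_coefM big_ord_recl big_ord_recr /= /fps_geom.
  rewrite dvdn0 subn0 dn /bump /= add1n cn subnn dvdn0 !mulr1 addrCA lerDr.
  by rewrite sumr_ge0 // => i _; rewrite mulr_ge0 //; case: (_ %| _)%N.
apply: le_trans gM2 _; rewrite /fps_rep !big_cons -/(fps_rep cs) mulrA.
rewrite [leRHS]fps_coefM big_ord_recr /= subnn fps_rep0 mulr1 lerDr.
by rewrite sumr_ge0 // => i _; rewrite mulr_ge0 ?fps_rep_ge0.
Qed.

(* The state of the algorithm when it enters round [j]. *)
Definition loop_invariant (eps : nat -> int) (j : nat) (cs : seq nat) : Prop :=
  [/\ sorted ltn cs, {in cs, forall c, (0 < c < j)%N} &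
      forall k, (k < j)%N -> fps_eps eps k = fps_rep cs k].

Section Algorithm.
Variable eps : nat -> int.
Hypothesis eps3 : forall j, (0 < j)%N -> eps j \in [:: -1; 0; 1].

(** Not stopping forces [0 <= n_j <= eps_j <= 1]. Either the two are equal and the list is kept, or
    [n_j = 0] and [eps_j = 1]; then appending [j] raises the coefficient of [X^j] by one and leaves
    the lower ones alone. *)
Lemma loop_invariant_step (j : nat) (cs : seq nat) : (0 < j)%N ->
    loop_invariant eps j cs -> ~~ (eps j < (nrep cs j)%:Z) ->
  loop_invariant eps j.+1
    (if (nrep cs j == 0%N) && (eps j == 1) then rcons cs j else cs).
Proof.
move=> j0 [scs csj csE] njs.
have csj' : {in cs, forall c, (0 < c)%N} by move=> c /csj /andP[].
have Ej : fps_eps eps j = eps j by case: j j0 {csj csE njs}.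
have nE := nrepE j csj'; rewrite -/(fps_rep cs) in nE.
have epsj := eps3 j0.
have [/andP[/eqP n0 /eqP e1]|nn] := ifP; split.
- rewrite -cats1; have := scs;
    elim: cs csj {scs csE njs csj' nE n0} => [|c [|d cs] IH] //= csj.
    by move=> _; have /andP[_ ->] := csj c (mem_head _ _).
  move=> /andP[-> /= H]; apply: IH => // x xs; apply: csj.
  by rewrite in_cons xs orbT.
- move=> c; rewrite mem_rcons inE => /predU1P[->|/csj /andP[-> cj]];
    first by rewrite j0 ltnSn.
  by rewrite ltnS ltnW.
- have [g0 gs] := fps_geom_sparse j.
  have [H1 H2] := fps_mul_sparse (fps_rep cs) g0 gs.
  move=> k; rewrite ltnS leq_eqVlt fps_rep_rcons => /predU1P[->|kj].
    by rewrite [RHS]H2 // Ej -nE n0 add0r fps_rep0 mul1r e1 /fps_geom dvdnn.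
  by rewrite [RHS]H1 // csE.
- by [].
- by move=> c /csj /andP[-> cj]; rewrite ltnS ltnW.
- move=> k; rewrite ltnS leq_eqVlt => /predU1P[->|/csE //].
  rewrite Ej -nE; move: epsj njs nn; rewrite !inE -leNgt => /or3P[]/eqP->.
  + by case: (nrep cs j).
  + by case: (nrep cs j).
  + by case: (nrep cs j) => [|[]].
Qed.

(** Termination is proved by choosing [m] large enough to refute the second alternative, or to read
    off what it implies. The prefix clause records that entries once chosen are kept. *)
Lemma loop_run (m j : nat) (cs : seq nat) : (0 < j)%N ->
    loop_invariant eps j cs ->
  (exists fuel l cs', [/\ algorithm_loop eps fuel j cs = Some (l, cs'),
     (j <= l)%N, loop_invariant eps l cs' & eps l < (nrep cs' l)%:Z]) \/
  (exists cs', [/\ loop_invariant eps (j + m) cs', prefix cs cs' &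
     forall fuel, algorithm_loop eps (m + fuel) j cs =
                  algorithm_loop eps fuel (j + m) cs']).
Proof.
elim: m j cs => [|m IH] j cs j0 inv.
  by right; exists cs; rewrite addn0 prefix_refl.
case: (boolP (eps j < (nrep cs j)%:Z)) => H.
  left; exists 1%N, j, cs; split=> //=; rewrite H.
  (* The round that stops appends nothing: [n = 0] and [eps j = 1] contradict [eps j < n]. *)
  case: ifP => // /andP[/eqP n0 /eqP e1].
  by move: H; rewrite n0 e1.
have := IH j.+1 _ isT (loop_invariant_step j0 inv H).
set cs1 := if _ then _ else _.
move=> [[fuel [l [cs' [run jl invl stop]]]]|[cs' [inv' pre run]]].
  left; exists fuel.+1, l, cs'; split=> //; last exact: ltnW.
  by rewrite /= (negPf H).
right; exists cs'; rewrite -addSnnS; split=> //.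
  apply: prefix_trans pre; rewrite /cs1; case: ifP => _;
    last exact: prefix_refl.
  exact: prefix_rcons.
by move=> fuel; rewrite -run addSn /= (negPf H).
Qed.

Lemma loop_invariant_init (c : nat) :
  initial_index eps c -> eps c = 1 -> loop_invariant eps c.+1 [:: c].
Proof.
move=> [c0 _ epsc] ec; split=> // [d|k].
  by rewrite inE => /eqP->; rewrite c0 ltnSn.
rewrite ltnS /fps_rep big_seq1 /fps_geom; case: k => [|k];
  first by rewrite dvdn0.
rewrite leq_eqVlt => /predU1P[kc|kc]; first by rewrite /fps_eps /= kc ec dvdnn.
by rewrite gtnNdvd // /fps_eps /= epsc.
Qed.

Lemma algorithm_terminates (c : nat) :
    initial_index eps c -> eps c = 1 ->
    (exists2 j, (0 < j)%N & eps j != (c %| j)%N%:R) ->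
  exists l cs, [/\ algorithm_outputs eps l cs, (0 < l)%N,
    loop_invariant eps l cs & eps l < (nrep cs l)%:Z].
Proof.
move=> ic ec [i i0 ei]; have c0 : (0 < c)%N by case: ic.
have inv := loop_invariant_init ic ec.
(* After [i] rounds the invariant covers the index [i], where [eps] differs from the indicator of
   the multiples of [c]; if the loop is still running, a second entry [d] has been chosen. *)
have [[fuel [l [cs [run jl invl stop]]]]|[cs [inv1 pre run]]] :=
    loop_run i (ltn0Sn c) inv.
  by exists l, cs; split=> //; [exists c, fuel|rewrite (leq_ltn_trans _ jl)].
case: cs pre inv1 run => [|c' [|d cs]] //;
  rewrite prefix_cons => /andP[/eqP<- _] inv1 run.
  case: inv1 => _ _ /(_ i); rewrite addSn ltnS leq_addl => /(_ isT).
  rewrite /fps_rep big_seq1; case: i i0 ei {run} => //= i _ /eqP ei ei'.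
  by case: ei.
(* After [c * d] further rounds the invariant would equate [eps (c * d)], which is at most 1, with a
   coefficient at least 2. *)
have [[fuel [l [cs' [run' jl invl stop]]]]|[cs' [inv2 pre2 _]]] :=
    @loop_run (c * d)%N (c.+1 + i)%N _ isT inv1.
  exists l, cs'; split=> //; last by rewrite (leq_trans _ jl).
  by exists c, (i + fuel)%N; rewrite run.
case: inv1 => _ /(_ d); rewrite !inE eqxx orbT => /(_ isT) /andP[d0 _] _.
case: cs' pre2 inv2 => [|c1 [|d1 cs']] //; rewrite !prefix_cons /= ?andbF //.
move=> /and3P[/eqP<- /eqP<- _] [_ _ /(_ (c * d)%N)].
rewrite addSn ltnS leq_addl => /(_ isT) E; have := fps_rep_ge2 cs' c0 d0.
have n0 : (0 < c * d)%N by rewrite muln_gt0 c0.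
rewrite -E; case: (c * d)%N n0 {E} => // n _; rewrite /fps_eps /=.
by have := eps3 (ltn0Sn n); rewrite !inE => /or3P[]/eqP->.
Qed.

End Algorithm.

(** * Multiplicative functions and indicators of powers *)

Lemma multiplicative_prod (f : nat -> int) (e : nat -> nat) (r : seq nat) :
    Defs.multiplicative f -> uniq r -> all prime r ->
  f (\prod_(p <- r) p ^ e p)%N = \prod_(p <- r) f (p ^ e p)%N.
Proof.
move=> [f1 fM]; elim: r => [|p r IH] /=; first by rewrite !big_nil.
move=> /andP[pr ur] /andP[pp pprime]; rewrite !big_cons fM ?IH //.
- by rewrite expn_gt0 prime_gt0.
- rewrite big_seq prodn_cond_gt0 // => q /(allP pprime) /prime_gt0 q0.
  by rewrite expn_gt0 q0.
elim: r pr pprime {ur IH} => [|q r IH]; first by rewrite big_nil coprimen1.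
rewrite inE negb_or => /andP[pq pr] /= /andP[qp rp].
rewrite big_cons coprimeMr IH // andbT coprimeXl // coprimeXr //.
by rewrite prime_coprime // dvdn_prime2.
Qed.

Lemma prod_primes (n : nat) : (0 < n)%N ->
  n = (\prod_(p <- primes n) p ^ logn p n)%N.
Proof. by move=> n0;
  rewrite {1}(prod_prime_decomp n0) prime_decompE big_map. Qed.

Lemma fake_mu_prod (f eps : nat -> int) (n : nat) : fake_mu f eps ->
  (0 < n)%N -> f n = \prod_(p <- primes n) eps (logn p n).
Proof.
move=> [fM _ fp] n0; rewrite {1}(prod_primes n0).
rewrite (@multiplicative_prod f (fun p => logn p n)) ?primes_uniq //;
  last first.
  by apply/allP => p; rewrite mem_primes => /andP[].
rewrite !big_seq; apply: eq_bigr => p pn; rewrite fp //.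
  by move: pn; rewrite mem_primes => /andP[].
by rewrite logn_gt0.
Qed.

(** By [fake_mu_prod] the value [f n] is 1 or 0 according as [k] divides every exponent [logn p n]
    or not, and this divisibility characterises the [k]th powers. *)
Lemma fake_mu_kth_powers (f eps : nat -> int) (k : nat) : (0 < k)%N ->
    fake_mu f eps -> (forall j, (0 < j)%N -> eps j = (k %| j)%N%:R) ->
  is_indicator_of f (kth_powers k).
Proof.
move=> k0 fmu epsE n n0; rewrite (fake_mu_prod fmu n0) indicE.
have [|/negP nS] := boolP (n \in kth_powers k).
  rewrite inE => -[m _ /= mn]; rewrite big_seq big1 // => p pn.
  by rewrite epsE ?logn_gt0 // -mn lognX dvdn_mulr.
have [|/allPn[p pn ndvd]] := boolP (all (fun p => k %| logn p n)%N (primes n)).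
  move=> /allP kn; case: nS; rewrite inE.
  exists (\prod_(p <- primes n) p ^ (logn p n %/ k))%N => //.
  rewrite [RHS](prod_primes n0) unstable.expn_prod big_seq [RHS]big_seq.
  by apply: eq_bigr => p pn; rewrite -expnM divnK // kn.
rewrite big_seq (big_rem p pn) /= pn epsE ?logn_gt0 // (negPf ndvd) mul0r.
by [].
Qed.

(** * The exponents [a j] up to index [2 l] *)

Lemma fps_factor0 (j : nat) : fps_factor j 0 = 1.
Proof. by []. Qed.

Lemma fps_prod_mem (cs : seq nat) (L : nat) : uniq cs ->
    {in cs, forall c, (0 < c <= L)%N} ->
  fps_prod (fun j => (j \in cs)%N%:R) L = fps_rep cs.
Proof.
move=> ucs csL; rewrite fps_prodE /fps_rep.
transitivity (\prod_(1 <= j < L.+1 | j \in cs) fps_geom j).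
  rewrite [RHS]big_mkcond; apply: eq_bigr => j _; case: (j \in cs).
    by rewrite -[RHS]mulr1.
  by rewrite fps_factor0.
rewrite -big_filter; apply: perm_big; apply: uniq_perm => //.
  by rewrite filter_uniq ?iota_uniq.
move=> j; rewrite mem_filter mem_index_iota ltnS.
by have [/csL|] := boolP (j \in cs).
Qed.

(** The coefficients below [X^l] determine the [a j] successively, and by the invariant the
    exponents [j \in cs] produce the same coefficients. At [X^l] the earlier factors contribute
    [nrep cs l], and [a l] makes up the difference. *)
Lemma loop_exponents (eps a : nat -> int) (l : nat) (cs : seq nat) :
    (0 < l)%N -> loop_invariant eps l cs -> zeta_exponents eps a ->
  (forall j, (0 < j < l)%N -> a j = (j \in cs)%N%:R) /\
  a l = eps l - (nrep cs l)%:Z.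
Proof.
move=> l0 [scs csl csE] aP; pose b j : int := (j \in cs)%N%:R.
have ucs := sorted_uniq ltn_trans ltnn scs.
(* The entries of [cs] are at most [l - 1], so the first [l - 1] factors already give all of
   [fps_rep cs]. *)
have bE L : (l.-1 <= L)%N -> fps_prod b L = fps_rep cs.
  move=> lL; apply: fps_prod_mem => // c /csl /andP[-> cl].
  by rewrite (leq_trans _ lL) // -ltnS prednK.
have aE j : (j.+1 < l)%N -> (forall i, (0 < i <= j)%N -> a i = b i) ->
    a j.+1 = b j.+1.
  move=> jl ab; have := aP _ _ (leqnn j.+1); rewrite fps_prodS (eq_fps_prod ab).
  rewrite -[eps_ext _ _]/(fps_eps eps j.+1) csE // -(bE _ (leqnn l.-1)).
  have jl1 : (j.+1 <= l.-1)%N by rewrite -ltnS prednK.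
  by rewrite (fps_prod_stable b jl1) fps_prodS => /addrI.
have ab j : (j < l)%N -> forall i, (0 < i <= j)%N -> a i = b i.
  elim: j => [|j IH] jl i; first by case: i.
  rewrite [(i <= _)%N]leq_eqVlt => /andP[i0 /predU1P[->|ij]].
    by apply: aE => // k; apply: IH; exact: ltnW.
  by apply: IH; rewrite ?i0 // ltnW.
split=> [j /andP[j0 jl]|]; first by apply: (ab j jl); rewrite j0 leqnn.
have csl0 : {in cs, forall c, (0 < c)%N} by move=> c /csl /andP[].
rewrite nrepE // -/(fps_rep cs) -(bE _ (leqnn l.-1)).
have := aP _ _ (leqnn l); case: l l0 {csl csE bE aE csl0} ab => // l _ ab /=.
by rewrite -[fps_mul _ _]/(fps_prod a l.+1) fps_prodS (eq_fps_prod (ab l (ltnSn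
  l))) => <-; rewrite addrC addKr.
Qed.

(** The factor is a power series in [X^j]. *)
Lemma fps_factor_dvd (j : nat) (a : int) (n : nat) :
  (0 < j)%N -> ~~ (j %| n)%N -> fps_factor j a n = 0.
Proof.
move=> j0.
have supp_exp (u : fps) k : (forall i, ~~ (j %| i)%N -> u i = 0) ->
    forall i, ~~ (j %| i)%N -> fps_exp u k i = 0.
  move=> u0; rewrite fps_expE; elim: k => [|k IH] i ji.
    by rewrite expr0 fps_coef1; case: i ji; rewrite ?dvdn0.
  rewrite exprS fps_coefM big1 // => -[h /= hi] _.
  have [jh|nh] := boolP (j %| h)%N; last by rewrite u0 ?mul0r.
  rewrite IH ?mulr0 //; apply: contra ji => jih.
  by rewrite -(subnK (hi : (h <= i)%N)) dvdn_add.
case: a => k; apply: supp_exp => i; first by rewrite /fps_geom => /negPf->.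
rewrite /fps_1subXn => ji; case: eqP ji => [->|_]; first by rewrite dvdn0.
by case: eqP => [->|//]; rewrite dvdnn.
Qed.

Lemma fps_1subXnM (v : fps) (j n : nat) : (0 < j)%N ->
  (fps_1subXn j * v) n = v n - (if (j <= n)%N then v (n - j)%N else 0).
Proof.
move=> j0; rewrite fps_coefM /fps_1subXn.
under eq_bigr do rewrite mulrBl.
rewrite sumrB; congr (_ - _).
  by rewrite big_ord_recl big1 ?addr0 ?mul1r ?subn0 // => i _; rewrite mul0r.
case: ifP => jn; last first.
  rewrite big1 // => i _; rewrite (_ : (_ == j) = false) ?mul0r //.
  by apply/eqP => ij; have := ltn_ord i; rewrite ltnS ij jn.
rewrite (bigD1 (Ordinal (jn : (j < n.+1)%N))) //= eqxx mul1r big1 ?addr0 //.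
by move=> i; rewrite -val_eqE /= => /negPf ->; rewrite mul0r.
Qed.

(** The coefficient is the binomial coefficient of [k] over 2; doubling avoids a division in the
    induction. *)
Lemma fps_1subXn_exp2 (j k : nat) : (0 < j)%N ->
  2 * fps_exp (fps_1subXn j) k (2 * j)%N = k%:Z ^+ 2 - k%:Z.
Proof.
move=> j0; elim: k => [|k IH].
  by rewrite /= /fps_one muln_eq0 (gtn_eqF j0).
have [||_ _ ej] := @fps_exp_sparse (fps_1subXn j) j k j0.
- by rewrite /fps_1subXn eqxx ltn_eqF // subr0.
- by move=> i /andP[i0 ij]; rewrite /fps_1subXn (gtn_eqF i0) (ltn_eqF ij).
have -> : fps_exp (fps_1subXn j) k.+1 = fps_1subXn j * fps_exp (fps_1subXn j) k
  by [].
rewrite fps_1subXnM // leq_pmull // mulrBr IH mul2n -addnn addnK ej.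
have -> : fps_1subXn j j = -1 by rewrite /fps_1subXn eqxx gtn_eqF // sub0r.
by rewrite mulNrn natz intS; ring.
Qed.

(** Nonconstant terms of two distinct factors of index at least [l] multiply to degree at least
    [2 l + 1]. Up to degree [2 l] the coefficients therefore add up, each factor giving its leading
    term [b k], and only the factor of index [l] reaches its second term, in degree [2 l]. *)
Lemma fps_prod_tail (b : nat -> int) (l m k : nat) : (0 < l)%N ->
    (forall j, (0 < j < l)%N -> b j = 0) -> (l <= m)%N -> (k <= 2 * l)%N ->
  fps_prod b m k = (k == 0%N)%:R + (if (l <= k <= m)%N then b k else 0)
    + (if k == (2 * l)%N then fps_factor l (b l) (2 * l)%N else 0).
Proof.
move=> l0 b0 lm; move: k; have l20 : (0 < 2 * l)%N by rewrite muln_gt0.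
elim: m lm => [|m IH]; first by rewrite leqNgt l0.
rewrite leq_eqVlt => /predU1P[lm|].
  move=> k kl; have -> : fps_prod b m.+1 = fps_factor l (b l).
    rewrite -lm fps_prodE big_nat_recr ?lm //= -lm big_nat_cond big1 ?mul1r //.
    move=> j /andP[jl _]; by rewrite b0.
  rewrite -lm -eqn_leq; have [f0 fs fl] := fps_factor_sparse (b l) l0.
  have [->|k0] := eqVneq k 0%N;
    first by rewrite f0 (gtn_eqF l0) (ltn_eqF l20) !addr0.
  rewrite add0r; have [<-|lk] := eqVneq l k.
    by rewrite fl ltn_eqF ?addr0 // -[ltnLHS]mul1n ltn_pmul2r.
  rewrite add0r; have [->//|k2] := eqVneq k (2 * l)%N.
  have [kl1|lk1] := ltnP k l; first by rewrite fs // kl1 lt0n k0.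
  rewrite fps_factor_dvd //; apply/negP => /dvdnP[q kq].
  move: kl k2 k0 lk; rewrite kq leq_pmul2r // eqn_pmul2r //.
  by case: q {kq} => [|[|[|]]] //; rewrite mul1n eqxx.
rewrite ltnS => lm k kl; have {}IH := IH lm.
have [f0 fs fl] := fps_factor_sparse (b m.+1) (ltn0Sn m).
have [->|k0] := eqVneq k 0%N.
  by rewrite fps_prod0 leqNgt l0 (ltn_eqF l20) !addr0.
(* Cross terms vanish: nonconstant terms have degree at least [l] in the earlier product and at
   least [m + 1 > l] in the new factor, while [k <= 2 l]. *)
have -> : fps_prod b m.+1 k = fps_prod b m k + fps_factor m.+1 (b m.+1) k.
  have -> : fps_prod b m.+1 = fps_prod b m * fps_factor m.+1 (b m.+1) by [].
  rewrite fps_coefM big_ord_recr /= subnn f0 mulr1 addrC; congr (_ + _).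
  case: k k0 kl => // k _ kl; rewrite big_ord_recl fps_prod0 mul1r subn0.
  rewrite big1 ?addr0 // => i _; rewrite lift0.
  have ik : (i < k)%N := ltn_ord i.
  have [il|li] := ltnP i.+1 l; last first.
    rewrite [fps_factor _ _ _]fs ?mulr0 // subSS subn_gt0 ik /=.
    rewrite ltnS leq_subLR; move: ik li kl lm; lia.
  rewrite IH ?(leq_trans _ kl) //; last by rewrite ltnW.
  by rewrite leqNgt il /= add0r ltn_eqF ?mul0r // (leq_trans _ kl).
rewrite IH // (negPf k0) !add0r addrAC; congr (_ + _).
have [->|km] := eqVneq k m.+1.
  by rewrite fl ltnn andbF add0r leqW // leqnn.
rewrite [(k <= m.+1)%N]leq_eqVlt (negPf km) /= ltnS.
case: (ltnP k m.+1) => mk; first by rewrite fs ?addr0 // lt0n k0.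
rewrite fps_factor_dvd ?addr0 //; apply/negP => /dvdnP[q kq].
case: q kq k0 km mk kl => [|[|q]]; lia.
Qed.

Lemma exponents_upto_2l (eps a : nat -> int) (l : nat) (cs : seq nat) :
    (0 < l)%N -> loop_invariant eps l cs -> zeta_exponents eps a -> a l < 0 ->
  (forall j, (l < j < 2 * l)%N -> a j = alt_sum eps cs j) /\
  a (2 * l)%N = - ((a l ^+ 2 + a l) %/ 2)%Z + alt_sum eps cs (2 * l)%N.
Proof.
move=> l0 inv aP al0; have [ab _] := loop_exponents l0 inv aP.
have [scs csl _] := inv.
(* The exponents split as [b] on the principal indices and [t] from [l] onwards; multiplying by the
   [1 - X^c] cancels the first part. *)
pose b j : int := (j \in cs)%N%:R; pose t j := if (j < l)%N then 0 else a j.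
have l2 : (l < 2 * l)%N by rewrite -[ltnLHS]mul1n ltn_pmul2r.
have prodE : fps_prod a (2 * l) = fps_rep cs * fps_prod t (2 * l).
  rewrite -(@fps_prod_mem cs (2 * l)) ?(sorted_uniq ltn_trans ltnn) //;
    last first.
    by move=> c /csl /andP[-> cl]; rewrite (leq_trans (ltnW cl)) // ltnW.
  apply: fps_prod_disjoint => j /andP[j0 _]; rewrite /t; case: ltnP => jl.
    by left; rewrite ab ?j0.
  right; split=> //; case: (boolP (j \in cs)) => // /csl /andP[_].
  by rewrite ltnNge jl.
have altE n : (n <= 2 * l)%N -> alt_sum eps cs n = fps_prod t (2 * l) n.
  move=> nl; have -> : fps_prod t (2 * l) =
      fps_prod a (2 * l) * \prod_(c <- cs) fps_1subXn c.
    rewrite prodE mulrAC /fps_rep -big_split /= big_seq big1 ?mul1r // => c.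
    by move=> /csl /andP[c0 _]; rewrite mulrC fps_geomK.
  rewrite alt_sumE !fps_coefM; apply: eq_bigr => i _; rewrite aP //.
  by rewrite (leq_trans _ nl) // -ltnS.
have t0 j : (0 < j < l)%N -> t j = 0 by rewrite /t => /andP[_ ->].
have tE n : (n <= 2 * l)%N -> _ := fps_prod_tail l0 t0 (ltnW l2).
split=> [j /andP[lj jl]|].
  rewrite altE ?(ltnW jl) // tE ?(ltnW jl) // (ltnW lj) (ltn_eqF jl).
  by rewrite gtn_eqF ?(leq_trans _ lj) // add0r addr0 /t ltnNge (ltnW lj).
rewrite altE // tE // eqxx gtn_eqF ?muln_gt0 ?l0 // (ltnW l2) leqnn /= add0r.
have tl : t l = a l by rewrite /t ltnn.
rewrite {1}/t ltnNge (ltnW l2) /= tl addrC -addrA -[LHS]addr0; congr (_ + _).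
(* With [a l = -(k + 1)], the second coefficient of [(1 - X^l)^(k + 1)] is [k (k + 1) / 2], that is
   [(a_l^2 + a_l) / 2], so the integer division is exact. *)
case: (a l) al0 => // k _; rewrite /fps_factor.
have := fps_1subXn_exp2 k.+1 l0; set x := fps_exp _ _ _ => xE.
rewrite (_ : Negz k ^+ 2 + Negz k = x * 2) ?mulzK ?subrr //.
by rewrite mulrC xE NegzE; ring.
Qed.

(** * Complex limits and power series *)

Section ComplexLimits.
Variable R : realType.
Local Notation C := R[i].
Implicit Types (x y z : C).

(** The modulus with values in [R], whereas the norm of [R[i]] takes its values in [R[i]]. *)
Definition cabs z : R := Normc.normc z.

Lemma cabsM x y : cabs (x * y) = cabs x * cabs y.
Proof. exact: Normc.normcM. Qed.

Lemma cabsV x : cabs x^-1 = (cabs x)^-1.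
Proof. exact: Normc.normcV. Qed.

Lemma cabsD x y : cabs (x + y) <= cabs x + cabs y.
Proof. exact: le_normcD. Qed.

Lemma cabsN x : cabs (- x) = cabs x.
Proof. exact: normcN. Qed.

Lemma cabs_real (r : R) : cabs r%:C = `|r|.
Proof. by rewrite /cabs /= expr0n addr0 sqrtr_sqr. Qed.

Lemma cabs0 : cabs 0 = 0.
Proof. exact: Normc.normc0. Qed.

Lemma cabs1 : cabs 1 = 1.
Proof. exact: Normc.normc1. Qed.

Lemma cabs_ge0 x : 0 <= cabs x.
Proof. by case: x => a b; exact: sqrtr_ge0. Qed.

Lemma cabs_eq0 x : cabs x = 0 -> x = 0.
Proof. exact: Normc.eq0_normc. Qed.

Lemma cabsX x (n : nat) : cabs (x ^+ n) = cabs x ^+ n.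
Proof.
by elim: n => [|n IH]; rewrite ?expr0 ?cabs1 // !exprS cabsM IH.
Qed.

Lemma cabs_int (k : int) : cabs k%:~R = `|k|%:~R.
Proof. by rewrite -(rmorph_int (real_complex R)) intr_norm;
  exact: cabs_real. Qed.

Lemma cabs_sum (I : Type) (r : seq I) (P : pred I) (F : I -> C) :
  cabs (\sum_(i <- r | P i) F i) <= \sum_(i <- r | P i) cabs (F i).
Proof.
elim/big_ind2: _ => [|a b c d ab cd|//]; first by rewrite cabs0.
by apply: le_trans (cabsD _ _) _; exact: lerD.
Qed.

Lemma cabs_prod (I : Type) (r : seq I) (P : pred I) (F : I -> C) :
  cabs (\prod_(i <- r | P i) F i) = \prod_(i <- r | P i) cabs (F i).
Proof. exact: (big_morph _ cabsM cabs1). Qed.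

Lemma normr_Re_le z : `|complex.Re z| <= cabs z.
Proof. by rewrite -lecR; exact: normc_ge_Re. Qed.

Lemma normr_Im_le z : `|complex.Im z| <= cabs z.
Proof.
case: z => a b; rewrite /cabs /= -[leLHS]ger0_norm // -sqrtr_sqr.
by rewrite ler_wsqrtr // real_normK ?num_real // lerDr sqr_ge0.
Qed.

Lemma cabs_le_ReIm z : cabs z <= `|complex.Re z| + `|complex.Im z|.
Proof.
case: z => a b; rewrite /cabs /= -[leRHS]ger0_norm ?addr_ge0 // -sqrtr_sqr.
rewrite ler_wsqrtr // sqrrD !real_normK ?num_real // lerD2r lerDl.
by rewrite mulrn_wge0 // mulr_ge0.
Qed.

Lemma ReD x y : complex.Re (x + y) = complex.Re x + complex.Re y.
Proof. by case: x => a b; case: y. Qed.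

Lemma ImD x y : complex.Im (x + y) = complex.Im x + complex.Im y.
Proof. by case: x => a b; case: y. Qed.

(** Convergence in [R[i]], reduced to a real sequence so that real squeeze arguments apply; [ccvgP]
    is the bridge. *)
Definition ccvg (u : nat -> C) (l : C) : Prop :=
  (fun n => cabs (l - u n)) @ \oo --> (0 : R).

Lemma ccvg_le (u : nat -> C) (l : C) (v : nat -> R) :
  v @ \oo --> (0 : R) -> (\forall n \near \oo, cabs (l - u n) <= v n) ->
  ccvg u l.
Proof.
move=> v0 uv; apply: squeeze_cvgr (cvg_cst 0) v0.
by apply: filterS uv => n ->; rewrite cabs_ge0.
Qed.

Lemma ccvgP (u : nat -> C) (l : C) :
  ((u : nat -> C^o) @ \oo --> (l : C^o)) <-> ccvg u l.
Proof.
split=> H.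
  apply/cvgrPdist_lt => e e0; move/cvgrPdist_lt: H => /(_ e%:C).
  rewrite ltcR => /(_ e0); apply: filterS => n.
  by rewrite -[`|_|]/((cabs (l - u n))%:C) ltcR sub0r normrN ger0_norm //
    cabs_ge0.
apply/cvgrPdist_lt => e e0.
have er : e = (complex.Re e)%:C by rewrite RRe_real // gtr0_real.
move/cvgrPdist_lt: H => /(_ (complex.Re e)); rewrite -ltcR -er => /(_ e0).
apply: filterS => n; rewrite sub0r normrN ger0_norm ?cabs_ge0 //.
by rewrite -ltcR -er.
Qed.

Lemma lim_ccvg (u : nat -> C) (l : C) : ccvg u l -> limn (u : nat -> C^o) = l.
Proof. by move=> /ccvgP; apply: cvg_lim; exact: norm_hausdorff. Qed.

Lemma ccvg_unique (u : nat -> C) (l m : C) : ccvg u l -> ccvg u m -> l = m.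
Proof. by move=> /lim_ccvg <- /lim_ccvg. Qed.

Lemma ccvg_is_cvg (u : nat -> C) (l : C) : ccvg u l -> cvgn (u : nat -> C^o).
Proof. by move=> /ccvgP ul; apply/cvg_ex; exists l. Qed.

Lemma ccvg_cst (l : C) : ccvg (fun=> l) l.
Proof. by rewrite /ccvg subrr cabs0; exact: cvg_cst. Qed.

Lemma ccvg_cabs (u : nat -> C) (l : C) :
  ccvg u l -> (fun n => cabs (u n)) @ \oo --> cabs l.
Proof.
move=> ul; apply/cvgrPdist_lt => e e0; move/cvgrPdist_lt: ul => /(_ e e0).
apply: filterS => n; apply: le_lt_trans;
  rewrite sub0r normrN [leRHS]ger0_norm ?cabs_ge0 //.
have lu : cabs l <= cabs (l - u n) + cabs (u n).
  by apply: le_trans (cabsD _ _); rewrite subrK.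
have ul' : cabs (u n) <= cabs (l - u n) + cabs l.
  by rewrite -(cabsN (l - u n)); apply: le_trans (cabsD _ _);
    rewrite opprB subrK.
by rewrite ler_norml; apply/andP; split; lra.
Qed.

Lemma ccvgD (u v : nat -> C) (l m : C) :
  ccvg u l -> ccvg v m -> ccvg (fun n => u n + v n) (l + m).
Proof.
move=> ul vm; apply: (@ccvg_le _ _ (fun n => cabs (l - u n) + cabs (m - v n))).
  by rewrite -[X in _ --> X](addr0 (0 : R)); exact: cvgD.
by near=> n; rewrite opprD addrACA cabsD.
Unshelve. all: by end_near. Qed.

Lemma ccvgM (u v : nat -> C) (l m : C) :
  ccvg u l -> ccvg v m -> ccvg (fun n => u n * v n) (l * m).
Proof.
move=> ul vm; apply: (@ccvg_le _ _
    (fun n => cabs l * cabs (m - v n) + cabs (l - u n) * cabs (v n))).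
  have -> : 0 = cabs l * 0 + 0 * cabs m :> R by rewrite mulr0 mul0r addr0.
  apply: cvgD; apply: cvgM => //; first exact: cvg_cst.
  exact: ccvg_cabs.
near=> n; rewrite -!cabsM (_ : l * m - _ = l * (m - v n) + (l - u n) * v n).
  exact: cabsD.
by ring.
Unshelve. all: by end_near. Qed.

Lemma ccvgN (u : nat -> C) (l : C) : ccvg u l -> ccvg (fun n => - u n) (- l).
Proof.
move=> ul; rewrite /ccvg (_ : (fun n => _) = fun n => cabs (l - u n)) //.
by apply: funext => n; rewrite -[LHS]cabsN opprD !opprK.
Qed.

Lemma ccvgV (u : nat -> C) (l : C) :
  l != 0 -> ccvg u l -> ccvg (fun n => (u n)^-1) l^-1.
Proof.
move=> l0 ul; have cl0 : cabs l != 0 by apply: contra_neq l0; exact: cabs_eq0.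
have cu := ccvg_cabs ul.
apply: (@ccvg_le _ _ (fun n => cabs (l - u n) * ((cabs l)^-1 * (cabs (u
  n))^-1))).
  rewrite -(mul0r ((cabs l)^-1 * (cabs l)^-1)); apply: cvgM => //.
  by apply: cvgM; [exact: cvg_cst|exact: cvgV].
have : \forall n \near \oo, 0 < cabs (u n).
  by apply: (cvgr_gt _ cu); rewrite lt_def cl0 cabs_ge0.
apply: filterS => n un; have u0 : u n != 0.
  by apply: contraTneq un => ->; rewrite cabs0 ltxx.
rewrite -!cabsV -!cabsM -cabsN (_ : - _ = (l - u n) * (l^-1 * (u n)^-1)) //.
by field; rewrite l0 u0.
Qed.

Lemma ccvgX (u : nat -> C) (l : C) (a : int) :
  l != 0 -> ccvg u l -> ccvg (fun n => u n ^ a) (l ^ a).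
Proof.
move=> l0 ul; have Xn k : ccvg (fun n => u n ^+ k) (l ^+ k).
  elim: k => [|k IH]; first exact: ccvg_cst.
  by rewrite exprS (_ : (fun n => _) = fun n => u n * u n ^+ k);
    [exact: ccvgM|apply: funext => n; rewrite exprS].
by case: a => k; [exact: Xn|apply: ccvgV; [rewrite expf_neq0|exact: Xn]].
Qed.

Lemma ccvg_prod (I : Type) (r : seq I) (P : pred I) (u : I -> nat -> C)
    (l : I -> C) : (forall i, P i -> ccvg (u i) (l i)) ->
  ccvg (fun n => \prod_(i <- r | P i) u i n) (\prod_(i <- r | P i) l i).
Proof.
move=> ul; elim: r => [|i r IH].
  by under eq_fun do rewrite big_nil; rewrite big_nil; exact: ccvg_cst.
under eq_fun do rewrite big_cons; rewrite big_cons.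
by case: ifP => // Pi; apply: ccvgM => //; exact: ul.
Qed.

Lemma ccvg_shift (u : nat -> C) (l : C) (k : nat) :
  ccvg (fun n => u (n + k)%N) l <-> ccvg u l.
Proof. by rewrite /ccvg -(cvg_shiftn k (fun n => cabs (l - u n))). Qed.

Lemma ccvg_center (u : nat -> C) (l : C) (k : nat) :
  ccvg u l -> ccvg (fun n => u (n - k)%N) l.
Proof. by rewrite /ccvg -(cvg_centern k (fun n => cabs (l - u n))). Qed.

Lemma bounded_series_cvg (v : nat -> R) (M : R) : (forall n, 0 <= v n) ->
  (forall N, \sum_(0 <= n < N) v n <= M) -> cvgn (series v).
Proof.
move=> v0 vM; apply: nondecreasing_is_cvgn.
  by apply: nondecreasing_series => n _ _; exact: v0.
by exists M => _ [N _ <-]; exact: vM.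
Qed.

(** The bound [t m] is the sum of the series minus its partial sum. Arbitrary finite index sets are
    allowed because it is applied to smooth numbers, which do not form an interval. *)
Lemma bounded_series_tail (v : nat -> R) (M : R) : (forall n, 0 <= v n) ->
    (forall N, \sum_(0 <= n < N) v n <= M) ->
  exists2 t : nat -> R, (t n @[n --> \oo] --> (0 : R))%classic &
    forall m s, uniq s -> {in s, forall k, (m <= k)%N} ->
      \sum_(k <- s) v k <= t m.
Proof.
move=> v0 vM; have cv := bounded_series_cvg v0 vM.
exists (fun m => limn (series v) - series v m).
  rewrite -(subrr (limn (series v))); apply: cvgB => //; exact: cvg_cst.
move=> m s us ms; rewrite lerBrDr; pose K := (\max_(k <- s) k).+1.
have sK k : k \in s -> (k < K)%N by move=> ks;
  rewrite ltnS (leq_bigmax_seq _ ks).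
apply: (@le_trans _ _ (series v (maxn m K))); last first.
  apply: nondecreasing_cvgn_le => //.
  by apply: nondecreasing_series => n _ _; exact: v0.
rewrite /series /= (big_cat_nat (leq0n m) (leq_maxl m K)) /= [leLHS]addrC.
apply: lerD => //.
rewrite [leRHS](bigID (mem s)) /= -[leLHS]addr0 lerD //; last first.
  by apply: sumr_ge0 => k _; exact: v0.
rewrite -[leRHS]big_filter.
rewrite le_eqVlt; apply/orP; left; apply/eqP; apply: perm_big.
apply: uniq_perm => //; first by rewrite filter_uniq ?iota_uniq.
move=> k; rewrite mem_filter mem_index_iota.
have [ks|//] := boolP (k \in s).
by rewrite ms // (leq_trans (sK k ks)) // leq_maxr.
Qed.

(** The real and imaginary parts converge absolutely, being dominated by the moduli. *)
Lemma abs_series_cvg (u : nat -> C) (M : R) :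
    (forall N, \sum_(0 <= n < N) cabs (u n) <= M) ->
  exists l, ccvg (fun N => \sum_(0 <= n < N) u n) l.
Proof.
move=> uM; have cu := bounded_series_cvg (fun n => cabs_ge0 (u n)) uM.
have part (h : C -> R) : (forall z, `|h z| <= cabs z) ->
    cvgn (series (fun n => h (u n))).
  move=> hz; apply: (@normed_cvg _ R^o).
  apply: (series_le_cvg _ _ _ cu) => n //=; exact: cabs_ge0.
have /cvg_ex[a /= ca] := part _ normr_Re_le.
have /cvg_ex[b /= cb] := part _ normr_Im_le.
exists (a +i* b).
pose v N := `|a - series (fun n => complex.Re (u n)) N| +
  `|b - series (fun n => complex.Im (u n)) N|.
have ReS N : complex.Re (\sum_(0 <= n < N) u n) =
    series (fun n => complex.Re (u n)) N.
  by rewrite /series /=; apply: (big_morph _ ReD).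
have ImS N : complex.Im (\sum_(0 <= n < N) u n) =
    series (fun n => complex.Im (u n)) N.
  by rewrite /series /=; apply: (big_morph _ ImD).
apply: (@ccvg_le _ _ v).
  rewrite -[X in _ --> X](addr0 (0 : R)).
  by apply: cvgD; rewrite -(@normr0 _ R); apply: cvg_norm;
    [rewrite -(subrr a)|rewrite -(subrr b)]; apply: cvgB => //; exact: cvg_cst.
near=> N; apply: le_trans (cabs_le_ReIm _) _; rewrite /v -ReS -ImS.
by case: (\sum_(0 <= n < N) u n).
Unshelve. all: by end_near. Qed.

End ComplexLimits.

Lemma sum_shift (V : nmodType) (g : nat -> V) (j N : nat) :
  \sum_(0 <= n < N) (if (j <= n)%N then g (n - j)%N else 0) =
  \sum_(0 <= n < N - j) g n.
Proof.
have [Nj|jN] := leqP N j.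
  rewrite (eqP (Nj : (N - j == 0)%N)) [RHS]big_geq // big_nat big1 // => n nN.
  by rewrite leqNgt (leq_trans _ Nj) //.
rewrite (big_cat_nat (leq0n j) (ltnW jN)) /= [X in X + _]big_nat big1 ?add0r.
  rewrite -{1}(add0n j) big_addn; apply: eq_bigr => n _.
  by rewrite leq_addl addnK.
by move=> n /= nj; rewrite leqNgt nj.
Qed.

Section PowerSeries.
Variable R : realType.
Local Notation C := R[i].
Variable x : C.
Hypothesis x1 : cabs x < 1.

Definition pterm (u : fps) (n : nat) : C := (u n)%:~R * x ^+ n.

(** The bound on absolute partial sums is carried along because [evaluates_geom] derives from it the
    convergence of a new series. *)
Definition evaluates (u : fps) (U : C) : Prop :=
  (exists M : R, forall N, \sum_(0 <= n < N) cabs (pterm u n) <= M) /\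
  ccvg (fun N => \sum_(0 <= n < N) pterm u n) U.

Lemma evaluates_unique (u : fps) (U V : C) :
  evaluates u U -> evaluates u V -> U = V.
Proof. by move=> [_ HU] [_ HV]; exact: ccvg_unique HU HV. Qed.

Lemma evaluates_abs (u : fps) (M : R) :
  (forall N, \sum_(0 <= n < N) cabs (pterm u n) <= M) -> exists U, evaluates u
    U.
Proof.
by move=> uM; have [U cU] := abs_series_cvg uM; exists U; split=> //; exists M.
Qed.

Lemma evaluates_bounded (u : fps) : (forall n, `|u n| <= 1) ->
  exists U, evaluates u U.
Proof.
move=> u1; apply: (@evaluates_abs _ (1 - cabs x)^-1) => N.
apply: (@le_trans _ _ (\sum_(0 <= n < N) cabs x ^+ n)).
  apply: ler_sum => n _; rewrite /pterm cabsM cabs_int cabsX.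
  by rewrite ler_piMl ?exprn_ge0 ?cabs_ge0 // -[1]/(1%:~R) ler_int.
have x0 : 0 < 1 - cabs x by rewrite subr_gt0.
rewrite -[leRHS]mul1r ler_pdivlMr // mulrC big_mkord.
rewrite -opprB mulNr -subrX1 opprB lerBlDr lerDl.
by rewrite exprn_ge0 // cabs_ge0.
Qed.

Lemma evaluates1 : evaluates 1 1.
Proof.
have pt n : pterm 1 n = (n == 0%N)%:R.
  by rewrite /pterm fps_coef1; case: n => [|n]; rewrite ?expr0 ?mulr1 ?mul0r.
split.
  exists 1 => -[|N]; first by rewrite big_nil.
  rewrite big_nat_recl // big1 => [|n _]; rewrite pt ?addr0 ?cabs1 //.
  exact: cabs0.
apply/(ccvg_shift _ _ 1); under eq_fun => N.
  rewrite addn1 big_nat_recl // big1 => [|n _]; last by rewrite pt.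
  rewrite pt addr0; over.
exact: ccvg_cst.
Qed.

Lemma pterm_1subXn (u : fps) (j n : nat) : (0 < j)%N ->
  pterm (fps_1subXn j * u) n =
    pterm u n - (if (j <= n)%N then x ^+ j * pterm u (n - j) else 0).
Proof.
move=> j0; rewrite /pterm fps_1subXnM // rmorphB mulrBl; congr (_ - _).
case: ifP => jn; last by rewrite mul0r.
by rewrite mulrCA -exprD subnKC.
Qed.

Lemma evaluates_1subXn (u : fps) (U : C) (j : nat) : (0 < j)%N ->
  evaluates u U -> evaluates (fps_1subXn j * u) (U * (1 - x ^+ j)).
Proof.
move=> j0 [[M uM] cU]; split.
  exists (M + M) => N; under eq_bigr do rewrite pterm_1subXn //.
  apply: (@le_trans _ _ (\sum_(0 <= n < N) (cabs (pterm u n) +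
      (if (j <= n)%N then cabs (x ^+ j) * cabs (pterm u (n - j)) else 0)))).
    apply: ler_sum => n _; apply: le_trans (cabsD _ _) _; rewrite cabsN lerD2l.
    by case: ifP => _; rewrite ?cabsM // cabs0.
  rewrite big_split /= lerD ?uM //.
  rewrite (sum_shift (fun n => cabs (x ^+ j) * cabs (pterm u n))) -mulr_sumr.
  apply: le_trans (uM (N - j)%N); rewrite ler_piMl //.
    by apply: sumr_ge0 => n _; exact: cabs_ge0.
  by rewrite cabsX exprn_ile1 ?cabs_ge0 // ltW.
have -> : (fun N => \sum_(0 <= n < N) pterm (fps_1subXn j * u) n) =
    (fun N => \sum_(0 <= n < N) pterm u n +
              - (x ^+ j * \sum_(0 <= n < N - j) pterm u n)).
  apply: funext => N; under eq_bigr do rewrite pterm_1subXn //.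
  by rewrite sumrB (sum_shift (fun n => x ^+ j * pterm u n)) -mulr_sumr.
rewrite mulrBr mulr1 [U * _]mulrC; apply: ccvgD => //; apply: ccvgN.
by apply: ccvgM; [exact: ccvg_cst|exact: (ccvg_center j cU)].
Qed.

Lemma expr_neq1 (j : nat) : (0 < j)%N -> 1 - x ^+ j != 0.
Proof.
move=> j0; apply/eqP => /subr0_eq /(congr1 (@cabs R)).
rewrite cabs1 cabsX => H; have : cabs x ^+ j < 1.
  by rewrite exprn_ilt1 ?cabs_ge0 -?lt0n.
by rewrite -H ltxx.
Qed.

(** The product [v] satisfies [v_n = u_n + v_(n-j)], so its absolute partial sums [T] satisfy
    [T <= M + q T] with [q = |x|^j < 1]. Once [v] is known to converge, multiplying back by
    [1 - X^j] gives its value. *)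
Lemma evaluates_geom (u : fps) (U : C) (j : nat) : (0 < j)%N ->
  evaluates u U -> evaluates (fps_geom j * u) (U / (1 - x ^+ j)).
Proof.
move=> j0 uU; pose v : fps := fps_geom j * u; rewrite -/v.
have vu : fps_1subXn j * v = u by rewrite /v mulrA fps_geomK ?mul1r.
have [M uM] := uU.1; pose q := cabs (x ^+ j).
have q1 : 0 < 1 - q by rewrite subr_gt0 /q cabsX exprn_ilt1 ?cabs_ge0 -?lt0n.
have vM N : \sum_(0 <= n < N) cabs (pterm v n) <= M / (1 - q).
  rewrite ler_pdivlMr // mulrBr mulr1 lerBlDr.
  apply: (@le_trans _ _ (\sum_(0 <= n < N) (cabs (pterm u n) +
      (if (j <= n)%N then q * cabs (pterm v (n - j)) else 0)))).
    apply: ler_sum => n _; have := pterm_1subXn v n j0; rewrite vu.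
    set w := if _ then _ else 0 => ->; rewrite -[X in cabs X <= _](subrK w).
    apply: le_trans (cabsD _ _) _; rewrite lerD2l /w.
    by case: ifP => _; rewrite ?cabsM // cabs0.
  rewrite big_split /= lerD //.
  rewrite (sum_shift (fun n => q * cabs (pterm v n))) -mulr_sumr mulrC.
  rewrite ler_wpM2r ?cabs_ge0 //.
  rewrite [leRHS](big_cat_nat (leq0n (N - j)) (leq_subr j N)) /= lerDl.
  by apply: sumr_ge0 => n _; exact: cabs_ge0.
have [V vV] := evaluates_abs vM.
have := evaluates_1subXn j0 vV; rewrite vu => uV.
by rewrite (evaluates_unique uU uV) mulfK ?expr_neq1.
Qed.

Lemma evaluates_factor (u : fps) (U : C) (j : nat) (a : int) : (0 < j)%N ->
  evaluates u U -> evaluates (u * fps_factor j a) (U * (1 - x ^+ j) ^ (- a)).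
Proof.
move=> j0 uU; rewrite mulrC; case: a => k; rewrite /fps_factor fps_expE.
  rewrite -invr_expz -exprnP; elim: k => [|k IH].
    by rewrite mul1r expr0 invr1 mulr1.
  rewrite exprS -mulrA exprSr invfM [U * _]mulrA.
  exact: evaluates_geom.
rewrite NegzE opprK -exprnP; elim: k.+1 => [|n IH];
  first by rewrite mul1r mulr1.
rewrite exprS -mulrA exprSr [U * _]mulrA.
exact: evaluates_1subXn.
Qed.

Lemma evaluates_prod (u : fps) (U : C) (a : nat -> int) (L : nat) :
    evaluates u U ->
  evaluates (u * fps_prod a L) (U * \prod_(1 <= j < L.+1) (1 - x ^+ j) ^ (- a
    j)).
Proof.
move=> uU; elim: L => [|L IH]; first by rewrite big_nil !mulr1.
rewrite big_nat_recr // [U * _]mulrA.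
have -> : u * fps_prod a L.+1 = (u * fps_prod a L) * fps_factor L.+1 (a L.+1).
  by rewrite -mulrA.
exact: evaluates_factor.
Qed.

End PowerSeries.

(** * Euler products *)

(* The numbers whose prime factors are smaller than [N] and have multiplicity
   smaller than [K]. *)
Fixpoint smooth (K N : nat) : seq nat :=
  if N is p.+1 then
    if prime p then [seq (m * p ^ j)%N | m <- smooth K p, j <- iota 0 K]
    else smooth K p
  else [:: 1%N].

Lemma smooth_factors (K N n : nat) : n \in smooth K N ->
  (0 < n)%N /\ forall p, prime p -> (p %| n)%N -> (p < N)%N.
Proof.
elim: N n => [|q IH] n /=.
  by rewrite inE => /eqP->; split=> // p pp; rewrite dvdn1 => /eqP p1;
    rewrite p1 in pp.
case: ifP => qp; last first.
  by move=> /IH[n0 H]; split=> // p pp pn; rewrite ltnS ltnW // H.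
move=> /allpairsP[[m j] /= [/IH[m0 H] _ ->]].
split=> [|p pp]; first by rewrite muln_gt0 m0 expn_gt0 prime_gt0.
rewrite Euclid_dvdM // => /orP[pm|]; first by rewrite ltnS ltnW // H.
by rewrite Euclid_dvdX // dvdn_prime2 // => /andP[/eqP-> _].
Qed.

Lemma smooth_coprime (K p m : nat) : prime p -> m \in smooth K p -> coprime p m.
Proof.
move=> pp /smooth_factors[_ H]; rewrite prime_coprime //.
by apply/negP => /(H p pp); rewrite ltnn.
Qed.

(** Elements of [smooth K p] are prime to [p], so [logn p] recovers the exponent [j], and then
    [m]. *)
Lemma smooth_uniq (K N : nat) : uniq (smooth K N).
Proof.
elim: N => //= p IH; case: ifP => // pp.
apply: allpairs_uniq => //; first exact: iota_uniq.
move=> [m j] [m' j'] /allpairsP[[m1 j1] /= [mS _ [-> ->]]].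
move=> /allpairsP[[m2 j2] /= [mS' _ [-> ->]]] e.
have mp k i : k \in smooth K p -> logn p (k * p ^ i) = i.
  move=> kS; have [k0 _] := smooth_factors kS.
  have p0 : (0 < p ^ i)%N by rewrite expn_gt0 prime_gt0.
  by rewrite (lognM _ k0 p0) pfactorK // logn_coprime ?(smooth_coprime pp kS).
have ej : j1 = j2 by rewrite -(mp _ j1 mS) e mp.
move/eqP: e; rewrite ej eqn_pmul2r ?expn_gt0 ?prime_gt0 // => /eqP->.
by [].
Qed.

Lemma mem_smooth (K N n : nat) : (0 < K)%N -> (0 < n)%N ->
    (forall p, prime p -> (p %| n)%N -> (p < N)%N /\ (logn p n < K)%N) ->
  n \in smooth K N.
Proof.
move=> K0; elim: N n => [|q IH] n n0 H /=.
  rewrite inE eqn_leq n0 andbT leqNgt; apply/negP => n1.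
  by have [] := H _ (pdiv_prime n1) (pdiv_dvd n).
case: ifP => qp; last first.
  apply: IH => // p pp pn; have [] := H p pp pn.
  rewrite ltnS leq_eqVlt => /predU1P[pq|//]; by rewrite pq qp in pp.
have [m qm nE] := pfactor_coprime qp n0.
have m0 : (0 < m)%N by move: n0; rewrite nE muln_gt0 => /andP[].
have dmn : (m %| n)%N by rewrite nE dvdn_mulr.
apply/allpairsP; exists (m, logn q n); split=> //=.
  apply: IH => // p pp pm; have [] := H p pp (dvdn_trans pm dmn).
  rewrite ltnS leq_eqVlt => /predU1P[pq|pq] pK.
    by move: qm; rewrite prime_coprime // -pq pm.
  by split=> //; apply: leq_ltn_trans pK; exact: dvdn_leq_log.
rewrite mem_iota /= add0n; have [qn|nqn] := boolP (q %| n)%N.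
  by have [] := H q qp qn.
by rewrite lognE (negPf nqn) !andbF.
Qed.

Section EulerProduct.
Variable R : realType.
Local Notation C := R[i].
Variable u : nat -> C.
Hypothesis u0 : u 0%N = 0.
Hypothesis u1 : u 1%N = 1.
Hypothesis uM : forall m n, (0 < m)%N -> (0 < n)%N -> coprime m n ->
  u (m * n)%N = u m * u n.

Lemma sum_smooth (K N : nat) :
  \sum_(n <- smooth K N) u n =
  \prod_(0 <= p < N | prime p) \sum_(0 <= j < K) u (p ^ j)%N.
Proof.
elim: N => [|p IH]; first by rewrite big_seq1 big_nil.
rewrite [RHS]big_mkcond big_nat_recr //= -big_mkcond /=; case: ifP => pp;
  last first.
  by rewrite mulr1.
rewrite big_allpairs_dep -IH big_distrlr /= /index_iota subn0.
rewrite big_seq [RHS]big_seq; apply: eq_bigr => m mS; apply: eq_bigr => j _.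
have [m0 _] := smooth_factors mS.
have p0 : (0 < p ^ j)%N by rewrite expn_gt0 prime_gt0.
by rewrite (uM m0 p0) // coprime_sym coprimeXl // (smooth_coprime pp mS).
Qed.

Variable B : R.
Hypothesis uB : forall N, \sum_(0 <= n < N) cabs (u n) <= B.

(** For [K >= N] the list [smooth K N] contains every [n] with [0 < n < N], so its sum differs from
    the partial sum by terms of distinct indices at least [N], hence by at most the tail [t N]. This
    bound survives [K] tending to infinity, and then [N] does. *)
Lemma euler_product_cvg_to (L : nat -> C) (D : C) :
    (forall p, prime p ->
       ccvg (fun K => \sum_(0 <= j < K) u (p ^ j)%N) (L p)) ->
    ccvg (fun N => \sum_(0 <= n < N) u n) D ->
  ccvg (fun N => \prod_(0 <= p < N | prime p) L p) D.
Proof.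
move=> uL uD;
  have [t t0 tP] := bounded_series_tail (fun n => cabs_ge0 (u n)) uB.
have finite N K : (N <= K)%N ->
    cabs (\prod_(0 <= p < N | prime p) \sum_(0 <= j < K) u (p ^ j)%N -
          \sum_(0 <= n < N) u n) <= t N.
  move=> NK; rewrite -sum_smooth (bigID (fun n => n < N)%N) /=.
  rewrite (_ : \sum_(n <- smooth K N | (n < N)%N) u n = \sum_(0 <= n < N) u n).
    rewrite addrAC subrr add0r; apply: le_trans (cabs_sum _ _ _) _.
    rewrite -big_filter; apply: tP; first by rewrite filter_uniq ?smooth_uniq.
    by move=> k; rewrite mem_filter -leqNgt => /andP[].
  rewrite -big_filter; case: N NK => [|N] NK.
    by rewrite big_geq // big1_seq // => n /andP[_]; rewrite mem_filter ltn0.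
  rewrite [RHS]big_ltn // u0 add0r; apply: perm_big; apply: uniq_perm.
  - by rewrite filter_uniq ?smooth_uniq.
  - exact: iota_uniq.
  move=> n; rewrite mem_filter mem_index_iota andbC.
  have [n0|] := ltnP 0 n; last first.
    by rewrite leqn0 => /eqP->; apply/negbTE/negP => /andP[/smooth_factors[]].
  have [nN|] := ltnP n N.+1; last by rewrite andbF.
  rewrite andbT; apply: mem_smooth => [||p pp pn] //; first exact: leq_trans NK.
  split.
    by apply: leq_ltn_trans nN; exact: dvdn_leq.
  by apply: leq_trans NK; apply: ltn_trans nN; exact: ltn_logl.
have limit N : cabs (\prod_(0 <= p < N | prime p) L p - \sum_(0 <= n < N) u n)
  <= t N.
  have := ccvg_cabs (ccvgD (ccvg_prod (index_iota 0 N) uL)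
    (ccvg_cst (- \sum_(0 <= n < N) u n))).
  move=> H; rewrite -(cvg_lim (@norm_hausdorff _ _) H); apply: limr_le.
    by apply/cvg_ex; eexists; exact: H.
  by near=> K; apply: finite; near: K; exact: nbhs_infty_ge.
apply: (@ccvg_le _ _ _ (fun N => cabs (D - \sum_(0 <= n < N) u n) + t N)).
  rewrite -[X in _ --> X](addr0 (0 : R)); exact: cvgD.
near=> N; set S := \sum_(0 <= n < N) u n; set P := \prod_(_ <= _ < _ | _) _.
rewrite -(subrKA S D (- P)); apply: le_trans (cabsD _ _) _; rewrite lerD2l.
by rewrite -cabsN opprB limit.
Unshelve. all: by end_near. Qed.

End EulerProduct.

(** * The powers [n^-s] and their absolute summability *)

Section NatPowers.
Variable R : realType.
Local Notation C := R[i].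
Implicit Types (s z w : C) (m n p : nat).

Lemma cexpD z w : cexp (z + w) = cexp z * cexp w.
Proof.
rewrite /cexp ReD ImD expRD rmorphM /= cosD sinD.
rewrite mulrACA; congr (_ * _); apply/eqP; rewrite eq_complex /=.
by apply/andP; split; apply/eqP; ring.
Qed.

Lemma cexp0 : cexp 0 = 1 :> C.
Proof. by rewrite /cexp /= expR0 cos0 sin0 mul1r. Qed.

Lemma cabs_cexp z : cabs (cexp z) = expR (complex.Re z).
Proof.
rewrite /cexp cabsM cabs_real ger0_norm ?expR_ge0 // /cabs /= cos2Dsin2.
by rewrite sqrtr1 mulr1.
Qed.

Lemma nat_cpowN1 s : nat_cpowN 1 s = 1.
Proof. by rewrite /nat_cpowN ln1 mulr0 cexp0. Qed.

Lemma nat_cpowNM m n s : (0 < m)%N -> (0 < n)%N ->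
  nat_cpowN (m * n) s = nat_cpowN m s * nat_cpowN n s.
Proof.
move=> m0 n0; rewrite /nat_cpowN natrM lnM ?posrE ?ltr0n //.
by rewrite rmorphD mulrDr cexpD.
Qed.

Lemma nat_cpowNX n (j : nat) s : (0 < n)%N ->
  nat_cpowN (n ^ j) s = nat_cpowN n s ^+ j.
Proof.
move=> n0; elim: j => [|j IH]; first by rewrite expn0 nat_cpowN1 expr0.
by rewrite expnS exprS nat_cpowNM ?expn_gt0 ?n0 // IH.
Qed.

Lemma nat_cpowN_mull n (j : nat) s : nat_cpowN n (j%:R * s) = nat_cpowN n s ^+
  j.
Proof.
rewrite /nat_cpowN; elim: j => [|j IH];
  first by rewrite mul0r oppr0 mul0r cexp0.
by rewrite exprS -IH -cexpD; congr cexp; rewrite -natr1; ring.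
Qed.

Lemma Re_natM (j : nat) s : complex.Re (j%:R * s) = j%:R * complex.Re s.
Proof.
by case: s => a b; rewrite -(rmorph_nat (real_complex R)) /= mul0r subr0.
Qed.

Definition npow (n : nat) (sigma : R) : R := expR (- sigma * ln n%:R).

Lemma cabs_nat_cpowN n s : cabs (nat_cpowN n s) = npow n (complex.Re s).
Proof.
rewrite cabs_cexp /npow; congr expR.
by case: s => a b; rewrite /= mulr0 subr0.
Qed.

Lemma npow_ge0 n (sigma : R) : 0 <= npow n sigma.
Proof. exact: expR_ge0. Qed.

Lemma npowM m n (sigma : R) : (0 < m)%N -> (0 < n)%N ->
  npow (m * n) sigma = npow m sigma * npow n sigma.
Proof.
move=> m0 n0; rewrite /npow natrM lnM ?posrE ?ltr0n //.
by rewrite mulrDr expRD.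
Qed.

Lemma npow_le m n (sigma : R) : 0 < sigma -> (0 < m <= n)%N ->
  npow n sigma <= npow m sigma.
Proof.
move=> s0 /andP[m0 mn]; rewrite /npow ler_expR !mulNr lerN2 ler_pM2l //.
by rewrite ler_ln ?posrE ?ltr0n ?ler_nat // (leq_trans m0).
Qed.

Lemma npow_prime_lt1 p (sigma : R) : 0 < sigma -> (1 < p)%N -> npow p sigma < 1.
Proof.
by move=> s0 p1;
  rewrite /npow expR_lt1 mulNr oppr_lt0 mulr_gt0 // ln_gt0 // ltr1n.
Qed.

(* Pairing 2n with 2n+1 gives S(2N) <= 1 + q S(N), with q = 2^(1-sigma) < 1. *)
Lemma sum_npow_bounded (sigma : R) : 1 < sigma ->
  exists B, forall N, \sum_(1 <= n < N) npow n sigma <= B.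
Proof.
move=> s1; have s0 : 0 < sigma by exact: lt_trans s1.
pose S N := \sum_(1 <= n < N) npow n sigma; pose q := 2 * npow 2 sigma.
have SS N : (0 < N)%N -> S N.+1 = S N + npow N sigma.
  by move=> N0; rewrite /S big_nat_recr.
have q1 : 0 < 1 - q.
  rewrite subr_gt0 /q /npow -{1}(@lnK R 2) ?posrE ?ltr0n // -expRD expR_lt1.
  have l2 : 0 < ln 2 :> R by rewrite ln_gt0 // ltr1n.
  by nra.
have S2 N : (0 < N)%N -> S (2 * N)%N <= 1 + q * S N.
  case: N => // N _; elim: N => [|N IH].
    rewrite /S muln1 big_nat1 big_geq // mulr0 addr0.
    by rewrite /npow ln1 mulr0 expR0.
  have e : npow (2 * N.+1) sigma = npow 2 sigma * npow N.+1 sigma by rewrite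
    npowM.
  rewrite mulnS add2n (SS N.+1) //; set M := (2 * N.+1)%N in IH e *.
  have M0 : (0 < M)%N by rewrite muln_gt0.
  rewrite (SS M.+1) // (SS M) //.
  have : npow M.+1 sigma <= npow M sigma by apply: npow_le; rewrite ?M0 ?leqnSn.
  by rewrite e; move: IH; rewrite /q; lra.
(* The bound solves [S(N) <= S(2N) <= 1 + q S(N)]. *)
exists (1 - q)^-1 => -[|N]; first by rewrite big_geq // invr_ge0 ltW.
rewrite -/(S N.+1) -[leRHS]mul1r ler_pdivlMr // mulrBr mulr1 lerBlDr mulrC.
apply: le_trans (S2 _ (ltn0Sn N)).
rewrite /S [leRHS](big_cat_nat (n := N.+1)) //= ?leq_pmull // lerDl.
by apply: sumr_ge0 => n _; exact: npow_ge0.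
Qed.

End NatPowers.

(** * Euler products of fake mu's and of zeta, and the factorization *)

Section ZetaFactors.
Variable R : realType.
Local Notation C := R[i].
Implicit Types s : C.

Lemma cabs_prime_powN_lt1 (p : nat) s : 1 < complex.Re s -> prime p ->
  cabs (nat_cpowN p s) < 1.
Proof.
move=> s1 pp; rewrite cabs_nat_cpowN npow_prime_lt1 ?prime_gt1 //.
exact: lt_trans s1.
Qed.

Lemma fake_mu_le1 (f eps : nat -> int) (n : nat) : fake_mu f eps ->
  (0 < n)%N -> `|f n| <= 1.
Proof.
move=> fmu n0; rewrite (fake_mu_prod fmu n0) normr_prod.
rewrite big_seq; apply: prodr_ile1 => p pn; rewrite normr_ge0 /=.
by case: fmu => _ /(_ (logn p n));
  rewrite logn_gt0 !inE => /(_ pn) /or3P[]/eqP->.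
Qed.

Lemma eps_le1 (f eps : nat -> int) (j : nat) : fake_mu f eps ->
  (0 < j)%N -> `|eps j| <= 1.
Proof. by move=> [_ /(_ j) H _] /H; rewrite !inE => /or3P[]/eqP->. Qed.

Lemma fake_mu_euler (f eps : nat -> int) s (E : nat -> C) :
    fake_mu f eps -> 1 < complex.Re s ->
    (forall p, prime p -> evaluates (nat_cpowN p s) (fps_eps eps) (E p)) ->
  ccvg (fun N => \prod_(0 <= p < N | prime p) E p) (dirichlet_series f s).
Proof.
move=> fmu s1 EP.
(* The value [f 0] is arbitrary, so the term of index 0 is set to 0. *)
pose u n : C := if n is 0%N then 0 else (f n)%:~R * nat_cpowN n s.
have [[f1 fM] epsP fp] := fmu.
have [B BP] := sum_npow_bounded s1.
have sumu (V : nmodType) (g : nat -> V) N : g 0%N = 0 ->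
    \sum_(0 <= n < N) g n = \sum_(1 <= n < N) g n.
  by move=> g0; case: N => [|N]; [rewrite !big_geq|rewrite big_ltn // g0 add0r].
have uB N : \sum_(0 <= n < N) cabs (u n) <= B.
  rewrite sumu ?cabs0 //; apply: le_trans (BP N); rewrite !big_nat.
  apply: ler_sum => -[//|n] _; rewrite /u cabsM cabs_int cabs_nat_cpowN.
  rewrite ler_piMl ?npow_ge0 // -[1]/(1%:~R) ler_int.
  exact: (fake_mu_le1 fmu).
have [D uD] := abs_series_cvg uB.
have -> : dirichlet_series f s = D.
  apply: lim_ccvg;
    rewrite (_ : (fun N => _) = (fun N => \sum_(0 <= n < N) u n)) //.
  apply: funext => N; rewrite sumu // [LHS]big_nat [RHS]big_nat.
  by apply: eq_bigr => -[].
apply: (euler_product_cvg_to _ _ _ uB) => //.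
- by rewrite /u f1 nat_cpowN1 mulr1.
- move=> [//|m] [//|n] _ _ mn; rewrite -[LHS]/((f (m.+1 * n.+1)%N)%:~R * _).
  by rewrite fM // nat_cpowNM // rmorphM /u mulrACA.
move=> p pp; have [_] := EP p pp.
rewrite (_ : (fun N => _) = (fun K => \sum_(0 <= j < K) u (p ^ j)%N)) //.
apply: funext => N; apply: eq_bigr => j _; rewrite /pterm.
have pj : (0 < p ^ j)%N by rewrite expn_gt0 prime_gt0.
have uE n : (0 < n)%N -> u n = (f n)%:~R * nat_cpowN n s by case: n.
rewrite uE // nat_cpowNX ?prime_gt0 //; congr (_%:~R * _).
by case: j {pj} => [|j]; [rewrite expn0 f1|rewrite fp].
Qed.

(** This makes the Euler product of [zeta] an instance of [fake_mu_euler]. *)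
Lemma fake_mu1 : fake_mu (fun=> 1) (fun=> 1).
Proof. by split=> [|j _|//]; [split=> // m n; rewrite mulr1|rewrite !inE]. Qed.

Lemma zeta_euler s : 1 < complex.Re s ->
  ccvg (fun N => \prod_(0 <= p < N | prime p) (1 - nat_cpowN p s)^-1) (zeta s).
Proof.
move=> s1; apply: (fake_mu_euler fake_mu1 s1) => p pp.
have x1 := cabs_prime_powN_lt1 s1 pp.
have -> : fps_eps (fun=> 1) = fps_geom 1 * 1.
  by rewrite mulr1; apply: funext => -[|n]; rewrite /fps_geom dvd1n.
rewrite -[X in 1 - X]expr1 -[X in evaluates _ _ X]mul1r.
by apply: evaluates_geom => //; exact: evaluates1.
Qed.

(** From [|1 - p^-s| <= 1 + p^-sigma <= exp(p^-sigma)] the partial Euler products have modulus at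
    least [exp(-B)], where [B] bounds the sums of [n^-sigma]; the limit inherits this. *)
Lemma zeta_neq0 s : 1 < complex.Re s -> zeta s != 0.
Proof.
move=> s1; have [B BP] := sum_npow_bounded s1.
have PB N : \sum_(0 <= p < N | prime p) npow p (complex.Re s) <= B.
  apply: le_trans (BP N); case: N => [|N]; first by rewrite !big_geq.
  rewrite big_ltn_cond //= big_mkcond; apply: ler_sum => p _.
  by case: ifP => // _; exact: npow_ge0.
have cz := ccvg_cabs (zeta_euler s1).
have zB : expR (- B) <= cabs (zeta s).
  rewrite -(cvg_lim (@norm_hausdorff _ _) cz); apply: limr_ge.
    by apply/cvg_ex; eexists; exact: cz.
  near=> N; rewrite cabs_prod expRN.
  under eq_bigr do rewrite cabsV.
  rewrite prodfV lef_pV2 ?posrE ?expR_gt0 //; last first.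
    apply: prodr_gt0 => p pp; have x1 := cabs_prime_powN_lt1 s1 pp.
    rewrite lt_def cabs_ge0 andbT;
      apply: contraTneq x1 => /cabs_eq0/subr0_eq <-.
    by rewrite cabs1 ltxx.
  apply: (@le_trans _ _ (\prod_(0 <= p < N | prime p) expR (npow p (complex.Re
    s)))).
    apply: ler_prod => p pp; rewrite cabs_ge0 andTb.
    apply: le_trans (cabsD _ _) _; rewrite cabs1 cabsN cabs_nat_cpowN.
    exact: expR_ge1Dx.
  by rewrite -expR_sum ler_expR; exact: PB.
apply: contraTneq zB => ->; rewrite cabs0 -ltNge; exact: expR_gt0.
Unshelve. all: by end_near. Qed.

(** The coefficients of index at most [L] contribute exactly the 1 that [local_factor] adds to the
    tail. *)
Lemma local_factor_evaluates (eta : fps) (L p : nat) s (H : C) :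
    (forall n, (n <= L)%N -> eta n = (n == 0%N)%:R) ->
    evaluates (nat_cpowN p s) eta H ->
  cvgn (local_sum eta L s p) /\ local_factor eta L s p = H.
Proof.
move=> eta0 [_ cH].
have cl : ccvg (local_sum eta L s p) (H - 1).
  apply/(ccvg_shift _ _ L.+1).
  have := ccvgD (ccvg_cst (-1)) ((ccvg_shift _ _ L.+1).2 cH).
  rewrite addrC (_ : (fun n => _) = (fun n => local_sum eta L s p (n + L.+1)))
    //.
  apply: funext => n; rewrite (big_cat_nat (n := L.+1)) ?leq_addl //=.
  rewrite big_ltn // big_nat big1 => [|k /andP[k0 kL]]; last first.
    by rewrite /pterm eta0 // gtn_eqF // mul0r.
  rewrite /pterm eta0 // expr0 mulr1 addr0 addrA addNr add0r.
  by apply: eq_bigr => k _; rewrite nat_cpowN_mull.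
by split;
  [exact: ccvg_is_cvg cl|rewrite /local_factor (lim_ccvg cl) addrC subrK].
Qed.

Lemma dirichlet_factorization (f eps a : nat -> int) (L : nat) s :
    fake_mu f eps -> zeta_exponents eps a -> 1 < complex.Re s ->
  euler_product_cvg (remainder eps a L) L s /\
  dirichlet_series f s = euler_product (remainder eps a L) L s *
    \prod_(1 <= j < L.+1) zeta (j%:R * s) ^ a j.
Proof.
move=> fmu aP s1; set eta := remainder eps a L; set D := dirichlet_series f s.
pose E p : C := limn (fun N => \sum_(0 <= n < N) pterm (nat_cpowN p s) (fps_eps
  eps) n : C^o).
have EP p : prime p -> evaluates (nat_cpowN p s) (fps_eps eps) (E p).
  move=> pp;
    have [|U cU] := evaluates_bounded (cabs_prime_powN_lt1 s1 pp) (u := fps_eps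
      eps).
    by move=> n; apply: fps_eps_le1 => j; exact: eps_le1 fmu.
  by rewrite /E (lim_ccvg cU.2).
(* The value of [eta] at [p^-s]: the exponents [- a j] in [remainder] become [a j] on
   [1 - p^(-js)]. *)
pose H p : C := E p * \prod_(1 <= j < L.+1) (1 - nat_cpowN p s ^+ j) ^ a j.
have HP p : prime p -> evaluates (nat_cpowN p s) eta (H p).
  move=> pp; rewrite /H; under eq_bigr do rewrite -[a _]opprK.
  apply: (@evaluates_prod _ _ _ _ _ (fun j => - a j)); last exact: EP.
  exact: cabs_prime_powN_lt1.
have lP p : prime p -> cvgn (local_sum eta L s p) /\ local_factor eta L s p = H
  p.
  move=> pp; apply: local_factor_evaluates (HP p pp) => n.
  exact: remainder_low.
have sj j : (0 < j)%N -> 1 < complex.Re (j%:R * s).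
  move=> j0; rewrite Re_natM; apply: (lt_le_trans s1);
    rewrite ler_peMl ?ler1n //.
  by apply: ltW; exact: lt_trans s1.
have z0 j : (0 < j)%N -> zeta (j%:R * s) != 0 by move=> j0;
  exact: zeta_neq0 (sj j j0).
(* For each [N] the finite products over [p] and over [j] commute, which leaves partial Euler
   products of [f] and of the [zeta (j s)]; since the latter have nonzero limits, negative powers
   pass to the limit. *)
have ce : ccvg (partial_euler_product eta L s)
    (D * \prod_(1 <= j < L.+1) zeta (j%:R * s) ^ (- a j)).
  have -> : partial_euler_product eta L s = fun N =>
      (\prod_(0 <= p < N | prime p) E p) * \prod_(0 <= j < L)
        (\prod_(0 <= p < N | prime p) (1 - nat_cpowN p (j.+1%:R * s))^-1)
          ^ (- a j.+1).
    apply: funext => N; rewrite /partial_euler_product.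
    transitivity (\prod_(0 <= p < N | prime p) H p).
      case: N => [|N]; first by rewrite !big_geq.
      rewrite [RHS]big_ltn_cond //=.
      by apply: eq_bigr => p pp; have [_ ->] := lP p pp.
    rewrite /H big_split /=; congr (_ * _); rewrite exchange_big /= big_add1 /=.
    apply: eq_bigr => j _.
    rewrite (big_morph (fun z : C => z ^ (- a j.+1))
      (fun y z => expfzMl y z (- a j.+1)) (exp1rz _ _)).
    by apply: eq_bigr => p _; rewrite exprz_inv opprK nat_cpowN_mull.
  rewrite big_add1 /=; apply: ccvgM; first exact: fake_mu_euler fmu s1 EP.
  apply: ccvg_prod => j _; apply: ccvgX; first exact: z0.
  exact: zeta_euler (sj j.+1 isT).
split; first by split=> [p pp|]; [have [] := lP p pp|exact: ccvg_is_cvg ce].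
rewrite /euler_product (lim_ccvg ce) -mulrA -big_split /=.
rewrite big_nat big1 ?mulr1 // => j /andP[j0 _].
by rewrite -expfzDr ?z0 // addNr.
Qed.

End ZetaFactors.

(** * The constants, the initial coefficient and the final formula *)

Lemma poly_bounded_powR (R : realType) (K n : nat) (u : fps) : (0 < n)%N ->
  poly_bounded K u -> (`|u n|)%:~R <= (2 * n%:R) `^ K%:R :> R.
Proof.
move=> n0 uK; rewrite powR_mulrn ?mulr_ge0 // -natrM -natrX.
have := uK n; rewrite -(ler_int R) => /le_trans; apply.
(* The constant 2 comes from [n + 1 <= 2 n] for [n >= 1]. *)
by rewrite -[leLHS]/((n.+1 ^ K)%:R) ler_nat; case: K {uK} => // K;
  rewrite leq_exp2r // mul2n -addnn -addn1 leq_add2l.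
Qed.

Lemma initial_coef1 (eps : nat -> int) : powerfree_type eps \/ powerfull_type
  eps ->
  exists2 c, initial_index eps c & eps c = 1.
Proof.
move=> [e1|[k [ik _ ek]]]; last by exists k.
exists 1%N => //; split=> //; first by rewrite e1.
by move=> j; rewrite ltnS => /andP[j0]; rewrite leqNgt j0.
Qed.

Lemma prod_principal (F : fieldType) (z : nat -> F) (a : nat -> int) (l : nat)
    (cs : seq nat) : uniq cs -> {in cs, forall c, (0 < c < l)%N} ->
    (forall j, (0 < j < l)%N -> a j = (j \in cs)%N%:R) ->
  \prod_(1 <= j < l) z j ^ a j = \prod_(c <- cs) z c.
Proof.
move=> ucs csl aE; transitivity (\prod_(1 <= j < l | j \in cs) z j).
  rewrite [RHS]big_mkcond !big_nat; apply: eq_bigr => j jl; rewrite aE //.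
  by case: (j \in cs).
rewrite -big_filter; apply: perm_big; apply: uniq_perm => //.
  by rewrite filter_uniq ?iota_uniq.
by move=> j; rewrite mem_filter mem_index_iota;
  have [/csl|] := boolP (j \in cs).
Qed.

Theorem theorem2p6 (R : realType) :
  exists A B : nat -> R,
    (forall l : nat, 0 < A l) /\
    forall f eps a : nat -> int,
      in_F f ->
      fake_mu f eps ->
      powerfree_type eps \/ powerfull_type eps ->
      zeta_exponents eps a ->
      exists (l : nat) (cs : seq nat),
        algorithm_outputs eps l cs /\
        critical_index a l /\
        sorted ltn cs /\
        (forall j : nat, j \in cs <-> principal_index a l j) /\
        (forall j : nat, (l.+1 <= j <= (2 * l).-1)%N ->
           a j = alt_sum eps cs j) /\
        a (2 * l)%N =
          - (((eps l - (nrep cs l)%:Z) ^+ 2 + (eps l - (nrep cs l)%:Z)) %/ 2)%Z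
          + alt_sum eps cs (2 * l)%N /\
        exists eta : nat -> int,
          (forall j : nat, ((2 * l).+1 <= j)%N ->
             (`|eta j|)%:~R <= (A l * j%:R) `^ (B l)) /\
          forall s : R[i], 1 < complex.Re s ->
            euler_product_cvg eta (2 * l) s /\
            dirichlet_series f s =
              euler_product eta (2 * l) s
              * ((\prod_(c <- cs) zeta (c%:R * s))
                 / zeta (l%:R * s) ^ ((nrep cs l)%:Z - eps l))
              * \prod_(l.+1 <= j < (2 * l).+1) zeta (j%:R * s) ^ (a j).
Proof.
(* The exponent bounds the sum of the [|a j|] for [j <= 2 l] uniformly in [f]. *)
exists (fun=> 2), (fun l => (exponent_bound (2 * l))%:R); split=> // f eps a.
move=> [_ _ notpow] fmu eps_type aP.
have [_ eps3 _] := fmu.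
have eps1 j : (0 < j)%N -> `|eps j| <= 1 by exact: eps_le1 fmu.
have [c ic ec] := initial_coef1 eps_type.
(* If [eps] were the indicator of the multiples of [c], then [f] would be the indicator of the [c]th
   powers, which membership in the family excludes. *)
have [|l [cs [out l0 inv stop]]] := algorithm_terminates eps3 ic ec.
  have c0 : (0 < c)%N by case: ic.
  apply: contrapT => H; apply: (notpow c c0).
  apply: fake_mu_kth_powers fmu _ => // j j0.
  by apply/eqP/negPn/negP => ne; apply: H; exists j.
have [aE alE] := loop_exponents l0 inv aP.
have al0 : a l < 0 by rewrite alE subr_lt0.
have [scs csl _] := inv.
have [amid a2l] := exponents_upto_2l l0 inv aP al0.
exists l, cs; split=> //; split.
  by split=> // j jl; rewrite aE //; case: (_ \in _).
split=> //; split=> [j|].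
  split=> [jcs|[jl]]; first by rewrite /principal_index aE ?csl // jcs.
  by rewrite aE //; case: (_ \in _).
split=> [j /andP[lj jl]|].
  apply: amid; rewrite lj (leq_ltn_trans jl) //.
  by rewrite prednK ?muln_gt0.
split; first by rewrite -alE.
exists (remainder eps a (2 * l)); split=> [j lj|s s1].
  apply: poly_bounded_powR (remainder_bounded _ eps1 aP).
  exact: leq_trans lj.
have [cvgH ->] := dirichlet_factorization (2 * l) fmu aP s1; split=> //.
have l2 : (l <= 2 * l)%N by rewrite leq_pmull.
(* The indices below [l] give the principal factors, and [l] itself gives the denominator since
   [a l = eps l - n_l]. *)
rewrite (big_cat_nat (n := l.+1)) //= -[RHS]mulrA; congr (_ * (_ * _)).
rewrite big_nat_recr //= (prod_principal _ (sorted_uniq ltn_trans ltnn scs) csl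
  aE).
by rewrite invr_expz opprB alE.
Qed.
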